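(* Let $\psi:\mathbb{N}\to\mathbb{R}^+$ be an arbitrary function with $\lim_{n\to\infty}\psi(n)=\infty$, and let $$E_{\sup}(\psi)=\Big\{x\in(0,1]:\limsup_{n\to\infty}\frac{\log d_n(x)}{\psi(n)}=1\Big\}.$$ Then: (i) if $\lim_{n\to\infty}\frac{\psi(n)}{n}=0$, then $\dim_H E_{\sup}(\psi)=1$; (ii) if $\liminf_{n\to\infty}\frac{\psi(n)}{n}=\alpha$ with $0<\alpha<\infty$, then $\dim_H E_{\sup}(\psi)=H(\alpha)$, where $$H(\alpha)=\dim_H\big\{x\in(0,1]: d_n(x)\ge e^{\alpha n}\text{ for infinitely many } n\in\mathbb{N}\big\};$$ (iii) if $\lim_{n\to\infty}\frac{\psi(n)}{n}=\infty$, then $\dim_H E_{\sup}(\psi)=\frac{1}{1+A}$, where $A$ is given by $\log A=\liminf_{n\to\infty}\frac{\log\psi(n)}{n}$.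
   Context: Lüroth expansion: the Lüroth map $T:(0,1]\to(0,1]$ is $T(x)=d_1(x)(d_1(x)-1)\big(x-\frac{1}{d_1(x)}\big)$ with $d_1(x)=\lfloor 1/x\rfloor+1$, and the digits are $d_n(x)=d_1(T^{n-1}(x))$ for $n\ge2$. Every $x\in(0,1]$ then has the expansion $x=\frac{1}{d_1}+\frac{1}{d_1(d_1-1)d_2}+\cdots+\frac{1}{d_1(d_1-1)\cdots d_{n-1}(d_{n-1}-1)d_n}+\cdots$ with all digits $d_n(x)\ge2$. Here $\log$ is the natural logarithm and $\dim_H$ denotes Hausdorff dimension. In (iii), $A\in[1,\infty]$, with $\frac{1}{1+A}$ read as $0$ when $A=\infty$. *)

(* Defs.v *)
From HB Require Import structures.
From mathcomp Require Import all_boot all_order all_algebra.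
From mathcomp Require Import all_classical all_reals all_analysis.
Set Implicit Arguments.
Unset Strict Implicit.
Unset Printing Implicit Defensive.
Import Order.TTheory GRing.Theory Num.Theory.
Import numFieldNormedType.Exports.
Local Open Scope classical_set_scope.
Local Open Scope ring_scope.

Section HausdorffDimension.
Context {R : realType}.
Implicit Types (U E : set R) (s delta : R).

(* On the empty set this is -oo; the definitions below only use
   `diam U <= delta` and values at nonempty U. *)
Definition diam U : \bar R :=
  ereal_sup [set `|z.1 - z.2|%:E | z in U `*` U].

(* Empty covering sets contribute 0 for every exponent s, including s = 0
   (whereas 0 `^ 0 = 1, so that nonempty sets contribute 1 when s = 0).
   Countable covers are sequences; finite covers are padded with set0. *)
Definition diam_pow s U : \bar R :=
  if U == set0 then 0%E else (diam U `^ s)%E.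

Definition hausdorff_premeasure s delta E : \bar R :=
  ereal_inf [set (\sum_(0 <= i <oo) diam_pow s (U i))%E
    | U in [set U : (set R)^nat |
        E `<=` \bigcup_i U i /\ forall i, (diam (U i) <= delta%:E)%E]].

(* The premeasure is nonincreasing in delta, so this supremum is its limit
   as delta tends to 0 from the right. *)
Definition hausdorff_measure s E : \bar R :=
  ereal_sup [set hausdorff_premeasure s delta E
    | delta in [set delta | 0 < delta]].

Definition hausdorff_dim E : \bar R :=
  ereal_inf [set s%:E
    | s in [set s | 0 <= s /\ hausdorff_measure s E = 0%E]].

End HausdorffDimension.

Section Luroth.
Context {R : realType}.
Implicit Types (x alpha : R) (psi : nat -> R).

Definition luroth_digit1 x : int := Num.floor x^-1 + 1.

Definition luroth_map x : R :=
  let d : R := (luroth_digit1 x)%:~R in d * (d - 1) * (x - d^-1).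

(* Digits are numbered from 1; the value at n = 0 is irrelevant. *)
Definition luroth_digit (n : nat) x : int :=
  luroth_digit1 (iter n.-1 luroth_map x).

Definition E_sup psi : set R :=
  [set x | x \in `]0, 1] /\
    limn_esup (fun n => (ln (luroth_digit n x)%:~R / psi n)%:E) = 1%E].

Definition luroth_H alpha : \bar R :=
  hausdorff_dim [set x : R | x \in `]0, 1] /\
    infinite_set [set n : nat |
      (0 < n)%N /\ expR (alpha * n%:R) <= (luroth_digit n x)%:~R]].

End Luroth.

(* Main.v *)
(* A cylinder with digits [d_1 .. d_n] has length [\prod 1 / (d_i (d_i - 1))].

Upper bounds. Points with [d_{n+1} >= (d_1 ... d_n)^q e^{L n}] infinitely often
are covered by initial pieces of the cylinders, and the s-sum at level n is at
most a constant times [(e^{-L s} \sum_d (d (d - 1))^{-s} d^{-q s})^n]. With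
[q = 0] this settles linear growth. When [psi n >= B^n] with [B > b > 1], the
record values of [log d_n / b^n] give infinitely many n with
[log d_{n+1} >= (b - 1) log (d_1 ... d_n)], so [q] close to [b - 1] is allowed;
the exponent [s (1 + b) > 1] makes the digit sum converge.

Lower bounds. A point y of (0, 1] is expanded along prescribed digit weights,
and the resulting digits are read as Lüroth digits of a point x(y). If the
product of the weights is dominated by (cylinder length)^s up to a controlled
distortion, then [|y - y'| <= C |x(y) - x(y')|^s], so any cover of the image
pulls back to a cover of (0, 1], and Lebesgue measure bounds its s-sum below.
For [psi n] of linear order the weights are [(d (d - 1))^{-s}], normalised,
except at sparse positions where the digit is uniform on a block [N, 2N) with N
near [e^{psi n}]. For fast growth all digits are uniform on blocks near [e^{c_n}]
with [c_{n+1} = min (psi (n+1)) (b c_n)].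

In case (ii) no formula for H is needed: both sets have the same threshold, the
exponent at which [\sum_d (d (d - 1))^{-s}] crosses [e^{alpha s}]. *)
Require Import Defs.
From HB Require Import structures.
From mathcomp Require Import all_boot all_order all_algebra.
From mathcomp Require Import all_classical all_reals all_analysis.
From mathcomp Require Import ring lra zify.
Import Order.TTheory GRing.Theory Num.Theory.
Import numFieldNormedType.Exports.
Local Open Scope classical_set_scope.
Local Open Scope ring_scope.
Set Implicit Arguments.
Unset Strict Implicit.
Unset Printing Implicit Defensive.

(** * Upper and lower limits, Hausdorff dimension *)

Section Limits.
Context {R : realType}.
Implicit Types (u : nat -> \bar R) (l c : \bar R).

Lemma lt_limn_esup_exists u c : (c < limn_esup u)%E ->
  forall N, exists2 n, (N <= n)%N & (c < u n)%E.
Proof.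
move=> cu N; apply: contrapT => H.
move: cu; apply/negP; rewrite -leNgt /limn_esup /limf_esup.
apply: ge_ereal_inf; exists (ereal_sup [set u x | x in [set n | (N <= n)%N]]).
  exists [set n | (N <= n)%N] => //; exact: nbhs_infty_ge.
apply: ge_ereal_sup => _ [n /= Nn <-].
by rewrite leNgt; apply/negP => cn; apply: H; exists n.
Qed.

Lemma limn_esup_lt_near u c : (limn_esup u < c)%E ->
  exists N, forall n, (N <= n)%N -> (u n < c)%E.
Proof.
move=> /ereal_inf_lt[_ [V [N _ NV] <-]] Vc.
exists N => n Nn; apply: le_lt_trans Vc; apply: ereal_sup_ubound.
by exists n => //; exact: NV.
Qed.

Lemma limn_esup_le_near u c N :
  (forall n, (N <= n)%N -> (u n <= c)%E) -> (limn_esup u <= c)%E.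
Proof.
move=> H; rewrite leNgt; apply/negP => /lt_limn_esup_exists /(_ N)[n Nn].
by rewrite ltNge H.
Qed.

Lemma limn_esup_ge_often u c :
  (forall N, exists2 n, (N <= n)%N & (c <= u n)%E) -> (c <= limn_esup u)%E.
Proof.
move=> H; rewrite leNgt; apply/negP => /limn_esup_lt_near[N HN].
by have [n Nn] := H N; rewrite leNgt HN.
Qed.

Lemma limn_einf_lt_often u c : (limn_einf u < c)%E ->
  forall N, exists2 n, (N <= n)%N & (u n < c)%E.
Proof.
rewrite /limn_einf lteNl => /lt_limn_esup_exists + N => /(_ N)[n Nn].
by rewrite lteN2; exists n.
Qed.

Lemma lt_limn_einf_near u c : (c < limn_einf u)%E ->
  exists N, forall n, (N <= n)%N -> (c < u n)%E.
Proof.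
rewrite /limn_einf lteNr => /limn_esup_lt_near[N H].
by exists N => n /H; rewrite lteN2.
Qed.

Lemma cvgny_near (v : nat -> R) : v n @[n --> \oo] --> +oo ->
  forall M, exists N, forall n, (N <= n)%N -> M <= v n.
Proof.
by move=> /cvgryPge vy M; have [N _ H] := vy M; exists N => n /H.
Qed.

Lemma cvgn0_near (v : nat -> R) : v n @[n --> \oo] --> 0 ->
  forall e, 0 < e -> exists N, forall n, (N <= n)%N -> `|v n| < e.
Proof.
move=> /cvgr0_norm_lt v0 e e0; have [N _ H] := v0 e e0.
by exists N => n /H.
Qed.

End Limits.

Section Hausdorff.
Context {R : realType}.
Implicit Types (U E : set R) (s r : R).

Lemma le_diam U x y : U x -> U y -> (`|x - y|%:E <= diam U)%E.
Proof. by move=> Ux Uy; apply: ereal_sup_ubound; exists (x, y). Qed.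

Lemma diam_le U r : (forall x y, U x -> U y -> `|x - y| <= r) ->
  (diam U <= r%:E)%E.
Proof.
by move=> H; apply: ge_ereal_sup => _ [[x y] [/= Ux Uy] <-]; rewrite lee_fin H.
Qed.

Lemma diam_pow_ge0 s U : (0 <= diam_pow s U)%E.
Proof. by rewrite /diam_pow; case: ifP => // _; exact: poweR_ge0. Qed.

Lemma diam_ge0 U : U !=set0 -> (0 <= diam U)%E.
Proof.
by move=> [x Ux]; apply: le_trans (le_diam Ux Ux); rewrite lee_fin.
Qed.

Lemma diam_pow_le s U r : 0 <= s -> 0 <= r -> (diam U <= r%:E)%E ->
  (diam_pow s U <= (r `^ s)%:E)%E.
Proof.
move=> s0 r0 Ur; rewrite /diam_pow; case: ifPn => [_|U0].
  by rewrite lee_fin powR_ge0.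
rewrite -poweR_EFin; apply: gt0_ler_poweR => //.
- by rewrite in_itv/= leey andbT; apply: diam_ge0; apply/set0P.
- by rewrite in_itv/= leey andbT lee_fin.
Qed.

Lemma le_diam_pow s U x y : 0 <= s -> U x -> U y -> (diam U <= 1)%E ->
  ((`|x - y| `^ s)%:E <= diam_pow s U)%E.
Proof.
move=> s0 Ux Uy U1; rewrite /diam_pow ifF; last first.
  by apply/negbTE/set0P; exists x.
rewrite -poweR_EFin; apply: gt0_ler_poweR => //.
- by rewrite in_itv/= leey andbT lee_fin.
- by rewrite in_itv/= leey andbT; apply: diam_ge0; exists x.
- exact: le_diam.
Qed.

Lemma diam_set0 : diam (@set0 R) = -oo%E.
Proof.
rewrite /diam (_ : [set _ | _ in _] = set0) ?ereal_sup0//.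
by rewrite -subset0 => _ [? [[]]].
Qed.

Lemma hausdorff_dim_le E s : 0 <= s -> hausdorff_measure s E = 0%E ->
  (hausdorff_dim E <= s%:E)%E.
Proof. by move=> s0 Hs; apply: ereal_inf_lbound; exists s. Qed.

Lemma hausdorff_dim_ge0 E : (0 <= hausdorff_dim E)%E.
Proof. by apply: le_ereal_inf_tmp => _ [s [s0 _] <-]; rewrite lee_fin. Qed.

Lemma hausdorff_measure_eq0 E s :
  (forall delta e : R, 0 < delta -> 0 < e -> exists U : nat -> set R,
    [/\ E `<=` \bigcup_i U i, forall i, (diam (U i) <= delta%:E)%E
      & (\sum_(0 <= i <oo) diam_pow s (U i) <= e%:E)%E]) ->
  hausdorff_measure s E = 0%E.
Proof.
move=> H; apply/eqP; rewrite eq_le; apply/andP; split.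
  apply: ge_ereal_sup => _ [delta /= d0 <-]; apply/lee_addgt0Pr => e e0.
  have [U [EU Ud Us]] := H delta e d0 e0; rewrite add0e.
  by apply: ge_ereal_inf; exists (\sum_(0 <= i <oo) diam_pow s (U i))%E => //; exists U.
apply: le_ereal_sup_tmp; exists (hausdorff_premeasure s 1 E); first by exists 1 => /=.
apply: le_ereal_inf_tmp => _ [U _ <-]; apply: nneseries_ge0 => i _ _.
exact: diam_pow_ge0.
Qed.

Lemma hausdorff_dim_subset E F : E `<=` F -> (hausdorff_dim E <= hausdorff_dim F)%E.
Proof.
move=> EF; apply: le_ereal_inf_tmp => _ [s [s0 Hs] <-].
apply: hausdorff_dim_le => //; apply: hausdorff_measure_eq0 => d e d0 e0.
have : (hausdorff_premeasure s d F < e%:E)%E.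
  apply: (@le_lt_trans _ _ 0%E); last by rewrite lte_fin.
  by rewrite -Hs; apply: ereal_sup_ubound; exists d.
move=> /ereal_inf_lt[_ [U [FU Ud] <-] Ue].
by exists U; split => //; [exact: subset_trans FU|exact: ltW].
Qed.

(* The pullbacks of a cover of [E] lie in intervals of length [2 C (diam U)^s]
   that cover (0, 1]. *)
Lemma hausdorff_dim_ge_holder E s (C : R) (g : R -> R) : 0 <= s -> 0 < C ->
  (forall y : R, 0 < y <= 1 -> E (g y)) ->
  (forall y z : R, 0 < y <= 1 -> 0 < z <= 1 -> `|y - z| <= C * `|g y - g z| `^ s) ->
  (s%:E <= hausdorff_dim E)%E.
Proof.
move=> s0 C0 gE gs; apply: le_ereal_inf_tmp => _ [t [t0 Ht] <-].
rewrite lee_fin leNgt; apply/negP => ts.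
(* A t-sum below [e] gives the intervals [V i] total length below 2 C e = 1/2, less than the length
   of (0, 1]. *)
pose e := (4 * C)^-1.
have e0 : 0 < e by rewrite invr_gt0 mulr_gt0.
have : (hausdorff_premeasure t 1 E < e%:E)%E.
  apply: (@le_lt_trans _ _ 0%E); last by rewrite lte_fin.
  by rewrite -Ht; apply: ereal_sup_ubound; exists 1 => /=.
move=> /ereal_inf_lt[_ [U [EU U1] <-] Ue].
pose r i := fine (diam_pow t (U i)).
have Ufin i : diam_pow t (U i) \is a fin_num.
  rewrite ge0_fin_numE ?diam_pow_ge0//; apply: le_lt_trans (ltry (1 `^ t)).
  exact: diam_pow_le.
have r0 i : 0 <= r i by rewrite fine_ge0// diam_pow_ge0.
pose W i := [set y | 0 < y <= 1 /\ U i (g y)].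
pose V i := `[xget 0 (W i) - C * r i, xget 0 (W i) + C * r i]%classic.
have WV i : W i `<=` V i.
  move=> y Wy; have Wx : W i (xget 0 (W i)) by apply: xgetPex; exists y.
  rewrite /V /= in_itv/= -ler_distlC; apply: (le_trans (gs _ _ Wx.1 Wy.1)).
  apply: ler_wpM2l; first exact: ltW.
  rewrite -lee_fin fineK//.
  apply: le_trans (le_diam_pow t0 Wx.2 Wy.2 (U1 i)).
  have gd : `|g (xget 0 (W i)) - g y| <= 1.
    by rewrite -lee_fin; apply: le_trans (U1 i); apply: le_diam; [exact: Wx.2|exact: Wy.2].
  (* The exponent may drop from s to t because the distance is at most 1. A zero distance is treated
     apart: its s-th power is 0 because s > t >= 0. *)
  rewrite lee_fin; have [->|gn0] := eqVneq (g (xget 0 (W i)) - g y) 0.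
    rewrite normr0 [X in X <= _]powR0; first exact: powR_ge0.
    by rewrite gt_eqF// (le_lt_trans t0).
  by apply: ger_powR; rewrite ?normr_gt0 ?gn0//= ltW.
have cov : `]0, 1]%classic `<=` \bigcup_i V i.
  move=> y /=; rewrite in_itv/= => y01.
  have [i _ Ui] := EU _ (gE _ y01).
  by exists i => //; apply: WV.
have mV i : measurable (V i) by exact: measurable_itv.
pose I01 : set R := `]0, 1]%classic.
have : ((@lebesgue_measure R) I01 <=
    \sum_(0 <= i <oo) (@lebesgue_measure R) (V i))%E.
  by apply: measure_sigma_subadditive => //; exact: measurable_itv.
rewrite [X in (X <= _)%E]lebesgue_measure_itv/= lte_fin ltr01 oppr0 adde0.
apply/negP; rewrite -ltNge.
apply: (@le_lt_trans _ _ ((2 * C)%:E * \sum_(0 <= i <oo) diam_pow t (U i))%E).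
  rewrite -nneseriesZl; last by move=> i _; exact: diam_pow_ge0.
  apply: lee_nneseries => [i _ _|i _]; first exact: measure_ge0.
  rewrite lebesgue_measure_itv/=; case: ifPn => _; last first.
    by rewrite mule_ge0 ?diam_pow_ge0// lee_fin mulr_ge0// ltW.
  by rewrite -(fineK (Ufin i)) -/(r i) -EFinB -EFinM lee_fin; lra.
apply: (@lt_trans _ _ ((2 * C)%:E * e%:E)%E).
  by rewrite lte_pmul2l// lte_fin mulr_gt0.
rewrite -EFinM lte_fin (_ : 2 * C * e = 2^-1) ?invf_lt1 ?ltr1n// /e.
by field; rewrite gt_eqF.
Qed.

End Hausdorff.

(** * Covers indexed by words *)

Section Words.
Context {R : realType}.
Implicit Types (a u : nat -> R) (l : seq nat).

Lemma esum_nat_le u (B : R) : (forall k, 0 <= u k) ->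
  (forall M, \sum_(k < M) u k <= B) -> (\esum_(k in [set: nat]) (u k)%:E <= B%:E)%E.
Proof.
move=> u0 uB; rewrite -nneseries_esumT; last by move=> k; rewrite lee_fin.
apply: lime_le; first by apply: is_cvg_nneseries => k _ _; rewrite lee_fin.
by apply: nearW => M; rewrite sumEFin lee_fin big_mkord.
Qed.

(** The sum over words of length n is the n-th power of the sum over letters; the factor [c] absorbs
    the first letter in the induction. *)
Lemma esum_words_le a (K : R) n : (forall k, 0 <= a k) -> 0 <= K ->
  (forall M, \sum_(k < M) a k <= K) -> forall c : R, 0 <= c ->
  (\esum_(l in [set l | size l = n]) (c * \prod_(k <- l) a k)%:E <= (c * K ^+ n)%:E)%E.
Proof.
move=> a0 K0 aK; elim: n => [|n IH] c c0.
  rewrite (_ : [set l | _] = [set [::]]); last first.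
    by apply/seteqP; split => l /=; [exact: size0nil|move=> ->].
  rewrite esum_set1 big_nil ?lee_fin ?mulr1//.
have -> : [set l | size l = n.+1] =
    [set k.1 :: k.2 | k in [set: nat] `*`` (fun=> [set l | size l = n])].
  apply/seteqP; split => [[//|k l] /= [sl]|_ [[k l] /= [_ <-] <-]//].
  by exists (k, l).
rewrite esum_image; last by move=> [k l] [k' l'] _ _ [-> ->].
under eq_esum do rewrite big_cons mulrA.
rewrite -(@esum_esum _ _ _ _ _ (fun k l => (c * a k * \prod_(j <- l) a j)%:E)); last first.
  by move=> k l _ _; rewrite lee_fin mulr_ge0// ?mulr_ge0// prodr_ge0.
apply: (@le_trans _ _ (\esum_(k in [set: nat]) (c * K ^+ n * a k)%:E)).
  by apply: le_esum => k _; rewrite mulrAC; apply: IH; rewrite mulr_ge0.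
apply: esum_nat_le => [k|M]; first by rewrite mulr_ge0// mulr_ge0// exprn_ge0.
rewrite -mulr_sumr exprSr mulrA; apply: ler_wpM2l; last exact: aK.
by rewrite mulr_ge0// exprn_ge0.
Qed.

(** Turns a family indexed by words into a sequence, as the premeasure requires; integers that code
    nothing contribute 0. *)
Lemma nneseries_pickle (T : countType) (f : T -> \bar R) : (forall x, (0 <= f x)%E) ->
  (\sum_(0 <= i <oo) (if pickle_inv i is Some x then f x else 0) =
    \esum_(x in [set: T]) f x)%E.
Proof.
move=> f0; rewrite nneseries_esumT; last by move=> i; case: pickle_inv.
pose F i : \bar R := if @pickle_inv T i is Some x then f x else 0%E.
rewrite (@eq_esum R T setT f (F \o pickle)); last by move=> x _; rewrite /F/= pickleK_inv.
rewrite -(@esum_image R T nat setT pickle F); last first.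
  by move=> x y _ _; exact: (pcan_inj pickleK_inv).
rewrite [RHS]esum_mkcond; apply: eq_esum => i _; rewrite -/(F i). case: ifPn => //.
rewrite /F notin_setE; case E : pickle_inv => [x|//] [].
by exists x => //; have := @pickle_invK T i; rewrite E.
Qed.

Lemma geometric_sum_le (rho : R) n : 0 <= rho < 1 ->
  \sum_(i < n) rho ^+ i <= (1 - rho)^-1.
Proof.
move=> /andP[r0 r1]; have r1' : 0 < 1 - rho by rewrite subr_gt0.
rewrite -[leRHS]mul1r ler_pdivlMr// mulrC.
have := subrX1 rho n; have := exprn_ge0 n r0; nra.
Qed.

(** Only words of length at least some [n0] enter the cover. Those of length n contribute at most C
    (kappa K)^n, so the s-sum is the tail of a convergent geometric series, and all diameters are at
    most 2^(1 - n0). *)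
Lemma hausdorff_measure0_words (G : set R) (U : seq nat -> set R) (rr : seq nat -> R)
    a (s kappa K C : R) :
  0 <= s -> (forall l, 0 <= rr l <= 2 * 2^-1 ^+ size l) ->
  (forall l, (diam (U l) <= (rr l)%:E)%E) ->
  (forall x, G x -> forall n, exists2 l, (n <= size l)%N & U l x) ->
  (forall k, 0 <= a k) -> (forall M, \sum_(k < M) a k <= K) -> 0 <= kappa -> 0 <= C ->
  kappa * K < 1 ->
  (forall l, rr l `^ s <= C * kappa ^+ size l * \prod_(k <- l) a k) ->
  hausdorff_measure s G = 0%E.
Proof.
move=> s0 rr2 Urr GU a0 aK k0 C0 kK1 rrs; apply: hausdorff_measure_eq0 => d e d0 e0.
have K0 : 0 <= K by have := aK 0%N; rewrite big_ord0.
pose rho := kappa * K.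
have rho0 : 0 <= rho by rewrite mulr_ge0.
have [n0 [n0d n0e]] : exists n0, 2 * 2^-1 ^+ n0 <= d /\ C / (1 - rho) * rho ^+ n0 <= e.
  have h1 : 2 * (2^-1 : R) ^+ n @[n --> \oo] --> 2 * (0 : R).
    by apply: cvgMr; apply: cvg_expr; rewrite gtr0_norm ?invf_lt1// ltr1n.
  have h2 : C / (1 - rho) * rho ^+ n @[n --> \oo] --> C / (1 - rho) * (0 : R).
    by apply: cvgMr; apply: cvg_expr; rewrite ger0_norm.
  rewrite mulr0 in h1; rewrite mulr0 in h2.
  have [N1 H1] := cvgn0_near h1 d0; have [N2 H2] := cvgn0_near h2 e0.
  exists (maxn N1 N2); split.
    by apply: le_trans (ler_norm _) (ltW (H1 _ _)); exact: leq_maxl.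
  by apply: le_trans (ler_norm _) (ltW (H2 _ _)); exact: leq_maxr.
pose V l := if (n0 <= size l)%N then U l else set0.
exists (fun i => if pickle_inv i is Some l then V l else set0); split.
- move=> x Gx; have [l nl Ul] := GU x Gx n0.
  by exists (pickle l) => //; rewrite pickleK_inv /V nl.
- move=> i; case: pickle_inv => [l|]; last by rewrite diam_set0 leNye.
  rewrite /V; case: ifPn => nl; last by rewrite diam_set0 leNye.
  apply: le_trans (Urr l) _; rewrite lee_fin.
  apply: le_trans n0d; have /andP[_ /le_trans] := rr2 l; apply.
  by rewrite ler_pM2l// ler_wiXn2l// ?invr_ge0// invf_le1 ?ler1n.
- pose b n := if (n0 <= n)%N then C * kappa ^+ n else 0.
  have b0 n : 0 <= b n by rewrite /b; case: ifP => // _; rewrite mulr_ge0// exprn_ge0.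
  pose f l : \bar R := (b (size l) * \prod_(k <- l) a k)%:E.
  have f0 l : (0 <= f l)%E by rewrite lee_fin mulr_ge0// prodr_ge0.
  apply: (@le_trans _ _ (\sum_(0 <= i <oo) (if pickle_inv i is Some l then f l else 0))%E).
    apply: lee_nneseries => [i _ _|i _]; first exact: diam_pow_ge0.
    case: pickle_inv => [l|]; last by rewrite /diam_pow eqxx.
    rewrite /V /f /b; case: ifPn => nl; last by rewrite /diam_pow eqxx mul0r.
    apply: le_trans (diam_pow_le s0 _ (Urr l)) _; first by case/andP: (rr2 l).
    by rewrite lee_fin.
  rewrite nneseries_pickle//.
  have -> : [set: seq nat] = \bigcup_n [set l | size l = n].
    by apply/seteqP; split => // l _; exists (size l).
  rewrite esum_bigcupT//; last by move=> i j _ _ [l [/= <- <-]].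
  apply: (@le_trans _ _ (\esum_(n in [set: nat]) (b n * K ^+ n)%:E)%E).
    apply: le_esum => n _.
    rewrite (@eq_esum _ _ _ f (fun l => (b n * \prod_(k <- l) a k)%:E)); last first.
      by move=> l /= ln; rewrite /f ln.
    exact: esum_words_le.
  apply: esum_nat_le => [n|M]; first by rewrite mulr_ge0// exprn_ge0.
  apply: le_trans n0e.
  have [Mn|nM] := leqP M n0.
    rewrite big1 ?mulr_ge0 ?exprn_ge0 ?invr_ge0 ?subr_ge0 ?(ltW kK1)// => i _.
    by rewrite /b leqNgt (leq_trans (ltn_ord i) Mn) mul0r.
  rewrite -(big_mkord xpredT (fun n => b n * K ^+ n)) (big_cat_nat (n := n0))//=; last exact: ltnW.
  rewrite [X in X + _]big_nat_cond big1 ?add0r; last first.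
    by move=> i /andP[/andP[_ iN] _]; rewrite /b leqNgt iN mul0r.
  rewrite -{1}(add0n n0) big_addn.
  rewrite (eq_bigr (fun i => C * rho ^+ n0 * rho ^+ i)); last first.
    by move=> i _; rewrite /b leq_addl -!mulrA -exprMn -/rho -exprD addnC.
  rewrite -mulr_sumr [leRHS]mulrAC; apply: ler_wpM2l; first by rewrite mulr_ge0 ?exprn_ge0.
  by rewrite big_mkord; apply: geometric_sum_le; rewrite rho0.
Qed.

End Words.

(** * Cylinders of the Lüroth map *)

Section LurothMap.
Context {R : realType}.
Implicit Types (x z : R) (d : nat).

Definition digit x : nat := `|luroth_digit1 x|%N.

(** The inverse of the Lüroth map on (1/d, 1/(d - 1)]. *)
Definition branch d z : R := d%:R^-1 + z / (d%:R * (d%:R - 1)).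

Lemma floor_inv x d : d.+1%:R^-1 < x <= d%:R^-1 -> (0 < d)%N -> Num.floor x^-1 = d.
Proof.
move=> /andP[dx xd] d0; have x0 : 0 < x by apply: lt_trans dx; rewrite invr_gt0.
apply: floor_def; rewrite intrD -!pmulrn natr1; apply/andP; split.
  by rewrite -[d%:R]invrK lef_pV2 ?posrE ?invr_gt0 ?ltr0n.
by rewrite -[d.+1%:R]invrK ltf_pV2 ?posrE ?invr_gt0 ?ltr0n.
Qed.

Lemma digit1E x : 0 < x <= 1 -> luroth_digit1 x = digit x /\ (1 < digit x)%N.
Proof.
move=> /andP[x0 x1]; rewrite /digit /luroth_digit1.
have : 1 <= Num.floor x^-1.
  by rewrite -ltzD1 -(add0r 1) ltrD2r floor_gt0 -[1]invr1 lef_pV2 ?posrE.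
case: (Num.floor x^-1) => [k|//]; rewrite lez_nat => k1; split.
  by rewrite -PoszD absz_nat.
by rewrite -PoszD absz_nat addn1 ltnS.
Qed.

Lemma digit_itv x : 0 < x <= 1 -> (digit x)%:R^-1 < x <= ((digit x)%:R - 1)^-1.
Proof.
move=> x01; have [dE d1] := digit1E x01; case/andP: (x01) => x0 x1.
have d1' : 0 < (digit x)%:R - 1 :> R by rewrite subr_gt0 ltr1n.
have /andP[h1 h2] := floor_itv x^-1.
have E : (Num.floor x^-1 + 1)%:~R = (digit x)%:R :> R.
  by rewrite -/(luroth_digit1 x) dE -pmulrn.
apply/andP; split.
  by rewrite -[ltRHS]invrK ltf_pV2 ?posrE ?invr_gt0 ?ltr0n ?(ltn_trans _ d1)// -E.
rewrite -[leLHS]invrK lef_pV2 ?posrE ?invr_gt0//.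
by apply: le_trans h1; rewrite -E intrD addrK.
Qed.

Lemma luroth_mapE x : 0 < x <= 1 ->
  luroth_map x = (digit x)%:R * ((digit x)%:R - 1) * (x - (digit x)%:R^-1).
Proof. by move=> /digit1E[E _]; rewrite /luroth_map E -pmulrn. Qed.

Lemma branchK x : 0 < x <= 1 -> branch (digit x) (luroth_map x) = x.
Proof.
move=> x01; have [_ d1] := digit1E x01; rewrite luroth_mapE// /branch.
have d0 : (digit x)%:R != 0 :> R by rewrite pnatr_eq0 -lt0n (ltn_trans _ d1).
have d1' : (digit x)%:R - 1 != 0 :> R by rewrite subr_eq0 pnatr_eq1 gtn_eqF.
by field; apply/andP.
Qed.

Lemma luroth_map_itv x : 0 < x <= 1 -> 0 < luroth_map x <= 1.
Proof.
move=> x01; have [_ d1] := digit1E x01; rewrite luroth_mapE//.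
have /andP[h1 h2] := digit_itv x01.
have d0 : 0 < (digit x)%:R :> R by rewrite ltr0n (ltn_trans _ d1).
have d1' : 0 < (digit x)%:R - 1 :> R by rewrite subr_gt0 ltr1n.
apply/andP; split; first by rewrite mulr_gt0 ?subr_gt0// mulr_gt0.
rewrite mulrC -ler_pdivlMr ?mulr_gt0// lerBlDr; apply: (le_trans h2).
rewrite le_eqVlt; apply/orP; left; apply/eqP; field.
by rewrite !gt_eqF.
Qed.

Lemma digit_branch d z : (1 < d)%N -> 0 < z <= 1 -> digit (branch d z) = d.
Proof.
case: d => [//|d]; rewrite ltnS => d0 /andP[z0 z1]; rewrite /digit /luroth_digit1.
have dR : 0 < d%:R :> R by rewrite ltr0n.
rewrite (@floor_inv _ d)//; first by rewrite -PoszD absz_nat addn1.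
rewrite /branch -[d.+1%:R]natr1 addrK; apply/andP; split.
  by rewrite ltrDl divr_gt0// mulr_gt0// addr_gt0.
apply: (@le_trans _ _ ((d%:R + 1)^-1 + 1 / ((d%:R + 1) * d%:R))).
  by rewrite lerD2l ler_pM2r// invr_gt0 mulr_gt0// addr_gt0.
rewrite le_eqVlt; apply/orP; left; apply/eqP; field.
by rewrite !gt_eqF// addr_gt0.
Qed.

Lemma branch_itv d z : (1 < d)%N -> 0 < z <= 1 -> 0 < branch d z <= 1.
Proof.
move=> d1 /andP[z0 z1].
have dR : 1 < d%:R :> R by rewrite ltr1n.
have d2 : 2 <= d%:R :> R by rewrite ler_nat.
rewrite /branch; apply/andP; split.
  by rewrite addr_gt0 ?invr_gt0 ?divr_gt0 ?mulr_gt0//; lra.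
apply: (@le_trans _ _ (d%:R^-1 + 1 / (d%:R * (d%:R - 1)))).
  by rewrite lerD2l ler_pM2r// invr_gt0 mulr_gt0//; lra.
rewrite (_ : _ + _ = (d%:R - 1)^-1); last by field; rewrite !gt_eqF//; lra.
by rewrite invf_le1; lra.
Qed.

Lemma luroth_map_branch d z : (1 < d)%N -> 0 < z <= 1 -> luroth_map (branch d z) = z.
Proof.
move=> d1 z01; rewrite luroth_mapE ?branch_itv// digit_branch// /branch.
have dR : 1 < d%:R :> R by rewrite ltr1n.
by field; rewrite !gt_eqF//; lra.
Qed.

Lemma branchB d z z' : branch d z - branch d z' = (z - z') / (d%:R * (d%:R - 1)).
Proof. by rewrite /branch; ring. Qed.

Lemma iter_luroth_map_itv x n : 0 < x <= 1 -> 0 < iter n luroth_map x <= 1.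
Proof. by elim: n => //= n IH /IH; exact: luroth_map_itv. Qed.

Lemma luroth_digitE x n : 0 < x <= 1 ->
  (luroth_digit n.+1 x)%:~R = (digit (iter n luroth_map x))%:R :> R.
Proof.
by move=> x01; rewrite /luroth_digit/= (digit1E (iter_luroth_map_itv n x01)).1 -pmulrn.
Qed.

Fixpoint word n x : seq nat :=
  if n is n'.+1 then digit x :: word n' (luroth_map x) else [::].

(** A composition of inverse branches: for digits at least 2 it maps (0, 1] onto the cylinder of
    [l], with constant slope [cylinder_length l]. *)
Definition cylinder_map (l : seq nat) (z : R) : R := foldr branch z l.

Definition cylinder_length (l : seq nat) : R := \prod_(d <- l) (d%:R * (d%:R - 1))^-1.

Lemma size_word n x : size (word n x) = n.
Proof. by elim: n x => //= n IH x; rewrite IH. Qed.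

Lemma word_ge2 n x : 0 < x <= 1 -> all (leq 2) (word n x).
Proof.
elim: n x => //= n IH x x01; rewrite (digit1E x01).2/=.
by apply: IH; exact: luroth_map_itv.
Qed.

Lemma cylinder_map_word n x : 0 < x <= 1 ->
  cylinder_map (word n x) (iter n luroth_map x) = x.
Proof.
elim: n x => //= n IH x x01; rewrite -iterS iterSr IH ?luroth_map_itv//.
exact: branchK.
Qed.

Lemma prod_word n x (f : nat -> R) :
  \prod_(d <- word n x) f d = \prod_(i < n) f (digit (iter i luroth_map x)).
Proof.
elim: n x => [x|n IH x] /=; first by rewrite big_nil big_ord0.
rewrite big_cons IH big_ord_recl/=; congr (_ * _).
by apply: eq_bigr => i _; rewrite -iterSr.
Qed.

Lemma cylinder_mapB l z z' :
  cylinder_map l z - cylinder_map l z' = (z - z') * cylinder_length l.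
Proof.
rewrite /cylinder_length; elim: l => [|d l IH] /=; first by rewrite big_nil mulr1.
by rewrite branchB IH big_cons mulrA mulrAC.
Qed.

Lemma cylinder_length_itv l : all (leq 2) l ->
  0 < cylinder_length l <= 2^-1 ^+ size l.
Proof.
rewrite /cylinder_length; elim: l => [|d l IH] /=; first by rewrite big_nil expr0 ltr01 lexx.
move=> /andP[d2 /IH /andP[l0 l1]]; rewrite big_cons exprS.
have d2' : 2 <= d%:R :> R by rewrite ler_nat.
rewrite mulr_gt0 ?invr_gt0 ?mulr_gt0//=; [|lra|lra].
apply: ler_pM => //; rewrite ?invr_ge0 ?mulr_ge0//; [lra|exact: ltW|].
by rewrite lef_pV2 ?posrE ?mulr_gt0//; nra.
Qed.

End LurothMap.

Section Powers.
Context {R : realType}.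
Implicit Types (x y s : R).

Lemma le_powR x y s : 0 <= s -> 0 <= x -> x <= y -> x `^ s <= y `^ s.
Proof.
by move=> s0 x0 xy; apply: ge0_ler_powR; rewrite ?nnegrE//; exact: le_trans xy.
Qed.

Lemma powRV x s : 0 <= x -> x^-1 `^ s = (x `^ s)^-1.
Proof. by move=> x0; rewrite -powR_inv1// powRAC powR_inv1// powR_ge0. Qed.

Lemma powR_prod (I : Type) (r : seq I) (f : I -> R) s : (forall i, 0 <= f i) ->
  (\prod_(i <- r) f i) `^ s = \prod_(i <- r) f i `^ s.
Proof.
move=> f0; elim: r => [|i r IH]; first by rewrite !big_nil powR1.
by rewrite !big_cons powRM ?IH// prodr_ge0.
Qed.

Lemma powRXn x s n : 0 <= x -> (x ^+ n) `^ s = (x `^ s) ^+ n.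
Proof. by move=> x0; rewrite -powR_mulrn// powRAC powR_mulrn// powR_ge0. Qed.

Lemma half_powR_lt1 s : 0 < s -> 2^-1 `^ s < 1 :> R.
Proof.
move=> s0; rewrite [ltRHS](_ : 1 = 1 `^ s); last by rewrite powR1.
by apply: gt0_ltr_powR; rewrite ?nnegrE// invf_lt1 ?ltr1n.
Qed.

End Powers.

(** * Points with infinitely many large digits *)

Section UpperBound.
Context {R : realType}.
Implicit Types (x s q L K : R).

(** After a word of n digits, a next digit d puts the n-th iterate of x at or below 1/(d - 1). A
    large d thus confines x to an initial piece of the cylinder, of relative length [rho]; these
    pieces form the cover. *)
Lemma hausdorff_measure0_digits s q L K : 0 < s -> 0 <= q -> 0 <= L ->
  (forall M, \sum_(k < M)
     ((k.+2%:R * (k.+2%:R - 1))^-1 * (k.+2%:R `^ q)^-1) `^ s <= K) ->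
  expR (- L) `^ s * K < 1 ->
  hausdorff_measure s [set x : R | 0 < x <= 1 /\ forall N, exists2 n, (N <= n)%N &
    (\prod_(i < n) (digit (iter i luroth_map x))%:R) `^ q * expR L ^+ n <=
      (digit (iter n luroth_map x))%:R] = 0%E.
Proof.
move=> s0 q0 L0 aK LK1.
(* The letter k stands for the digit k + 2, so every word over the natural numbers is a valid digit
   string. *)
pose sh := map (addn 2).
have sh2 l : all (leq 2) (sh l) by rewrite all_map; apply/allP => k _ /=.
pose P l : R := \prod_(d <- l) (d%:R `^ q)^-1.
pose rho l : R := 2 * (P (sh l) * expR (- L) ^+ size l).
have P0 l : 0 <= P l by apply: prodr_ge0 => d _; rewrite invr_ge0 powR_ge0.
have P1 l : P (sh l) <= 1.
  rewrite /P; elim: l => [|k l IH] /=; first by rewrite big_nil.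
  rewrite big_cons; apply: mulr_ile1 => //; first exact: P0.
  rewrite invf_le1 ?powR_gt0 ?ltr0n// -[leLHS](powRr0 (k.+2%:R : R)).
  by rewrite ler_powR// ler1n.
have eL1 : expR (- L) <= 1 by rewrite -expR0 ler_expR oppr_le0.
have rho0 l : 0 <= rho l by rewrite !mulr_ge0// exprn_ge0// expR_ge0.
have rho2 l : rho l <= 2.
  by rewrite ler_piMr// mulr_ile1// ?exprn_ge0 ?expR_ge0// exprn_ile1// expR_ge0.
have cl l := cylinder_length_itv (R := R) (sh2 l).
apply: (@hausdorff_measure0_words R _
  (fun l => [set cylinder_map (sh l) z | z in [set z | 0 <= z <= rho l]])
  (fun l => rho l * cylinder_length (sh l))
  (fun k => ((k.+2%:R * (k.+2%:R - 1))^-1 * (k.+2%:R `^ q)^-1) `^ s)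
  s (expR (- L) `^ s) K (2 `^ s)) => //.
- exact: ltW.
- move=> l; have /andP[c0 c1] := cl l; rewrite mulr_ge0//=; last exact: ltW.
  rewrite size_map in c1.
  by apply: ler_pM => //; exact: ltW.
- move=> l; apply: diam_le => _ _ [z /= z01 <-] [z' /= z01' <-].
  have /andP[c0 c1] := cl l.
  rewrite cylinder_mapB normrM (ger0_norm (ltW c0)) ler_wpM2r ?(ltW c0)//.
  by rewrite ler_norml; lra.
- move=> x [x01 H] N; have [n Nn Hn] := H N.
  have [w wE] : exists w, sh w = word n x.
    exists [seq (d - 2)%N | d <- word n x]; rewrite /sh -map_comp map_id_in// => d dw /=.
    by rewrite subnKC//; exact: (allP (word_ge2 n x01)).
  have sw : size w = n by rewrite -(size_word n x) -wE size_map.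
  exists w; first by rewrite sw.
  exists (iter n luroth_map x); last by rewrite wE cylinder_map_word.
  have T01 := iter_luroth_map_itv n x01; have /andP[T0 T1] := T01.
  rewrite /= (ltW T0)/=.
  have /andP[_ T2] := digit_itv T01; have [_ d1] := digit1E T01.
  move: T2 Hn d1; set d := digit _ => T2 Hn d1.
  have d2 : 2 <= d%:R :> R by rewrite ler_nat.
  rewrite powR_prod// in Hn.
  (* 1/(d - 1) <= 2/d because d >= 2; this is the factor 2 in [rho]. *)
  apply: (le_trans T2); apply: (@le_trans _ _ (2 * d%:R^-1)).
    rewrite -[2]invrK -invfM lef_pV2 ?posrE; lra.
  rewrite ler_pM2l// /P wE prod_word sw expRN exprVn prodfV -invfM.
  have Q0 : 0 < \prod_(i < n) (digit (iter i luroth_map x))%:R `^ q.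
    apply: prodr_gt0 => i _; rewrite powR_gt0// ltr0n.
    by rewrite (ltn_trans _ (digit1E (iter_luroth_map_itv i x01)).2).
  rewrite lef_pV2// posrE ?mulr_gt0 ?exprn_gt0 ?expR_gt0//; lra.
- move=> l; have /andP[c0 c1] := cl l.
  have e0 : 0 <= expR (- L) ^+ size l by rewrite exprn_ge0 ?expR_ge0.
  rewrite /rho -!mulrA powRM ?mulr_ge0 ?(ltW c0)// ler_wpM2l ?powR_ge0//.
  rewrite mulrCA powRM ?mulr_ge0 ?(ltW c0)//.
  rewrite powRXn ?expR_ge0// ler_wpM2l ?exprn_ge0 ?powR_ge0//.
  by rewrite mulrC /cylinder_length /P /sh !big_map -big_split/= powR_prod.
Qed.

End UpperBound.

(** * Lower bounds *)

Section LurothPoint.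
Context {R : realType}.
Implicit Types (d : nat -> nat).

(** Partial sum of the Lüroth series with digits [d]: the tail of the expansion is replaced by 0. *)
Definition luroth_sum d n : R := cylinder_map (mkseq d n) 0.

Definition luroth_point d : R := limn (luroth_sum d).

Lemma luroth_sumS d n : luroth_sum d n.+1 = branch (d 0%N) (luroth_sum (d \o succn) n).
Proof.
rewrite /luroth_sum /mkseq/= -[1%N]addn0 iotaDl -map_comp; congr (branch _ (cylinder_map _ _)).
Qed.

Lemma le_branch k (z z' : R) : (1 < k)%N -> z <= z' -> branch k z <= branch k z'.
Proof.
move=> k1 zz'; rewrite -subr_ge0 branchB divr_ge0 ?subr_ge0//.
by rewrite mulr_ge0// subr_ge0 ler1n ltnW.
Qed.

Lemma luroth_sum_itv d n : (forall k, (1 < d k)%N) -> 0 <= luroth_sum d n <= 1.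
Proof.
elim: n d => [|n IH] d d2; first by rewrite /luroth_sum/= lexx ler01.
rewrite luroth_sumS; have /andP[h0 h1] := IH (d \o succn) (fun k => d2 k.+1).
have b1 : branch (d 0%N) 1 <= 1 :> R.
  by have /andP[] := @branch_itv R (d 0%N) 1 (d2 _) (introT andP (conj ltr01 (lexx _))).
apply/andP; split; last by apply: le_trans b1; apply: le_branch.
rewrite /branch addr_ge0 ?invr_ge0 ?divr_ge0// mulr_ge0// subr_ge0 ler1n ltnW//.
Qed.

Lemma luroth_sum_nd d : (forall k, (1 < d k)%N) -> nondecreasing_seq (luroth_sum d).
Proof.
move=> d2; apply/nondecreasing_seqP => n; elim: n d d2 => [|n IH] d d2.
  by have /andP[+ _] := luroth_sum_itv 1 d2.
by rewrite luroth_sumS [leRHS]luroth_sumS le_branch//; apply: IH => k; exact: d2.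
Qed.

Lemma luroth_sum_cvg d : (forall k, (1 < d k)%N) ->
  luroth_sum d n @[n --> \oo] --> luroth_point d.
Proof.
move=> d2; apply: nondecreasing_is_cvgn; first exact: luroth_sum_nd.
by exists 1 => _ [n _ <-]; have /andP[] := luroth_sum_itv n d2.
Qed.

Lemma luroth_point_branch d : (forall k, (1 < d k)%N) ->
  luroth_point d = branch (d 0%N) (luroth_point (d \o succn)).
Proof.
move=> d2.
have h1 : luroth_sum d n.+1 @[n --> \oo] --> luroth_point d.
  by have := luroth_sum_cvg d2; rewrite -(cvg_shiftS (luroth_sum d)).
have h2 : luroth_sum d n.+1 @[n --> \oo] -->
    branch (d 0%N) (luroth_point (d \o succn)).
  under eq_fun do rewrite luroth_sumS.
  apply: cvgD; first exact: cvg_cst.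
  by apply: cvgMl; apply: luroth_sum_cvg => k; exact: d2.
by rewrite -(cvg_lim (@Rhausdorff R) h1); exact: cvg_lim.
Qed.

Lemma luroth_point_itv d : (forall k, (1 < d k)%N) ->
  (d 0%N)%:R^-1 <= luroth_point d <= 1.
Proof.
move=> d2; apply/andP; split.
  apply: (@le_trans _ _ (luroth_sum d 1)); first by rewrite /luroth_sum/= /branch mul0r addr0.
  apply: nondecreasing_cvgn_le; first exact: luroth_sum_nd.
  exact: luroth_sum_cvg.
apply: limr_le; first exact: luroth_sum_cvg.
by apply: nearW => n; have /andP[] := luroth_sum_itv n d2.
Qed.

Lemma luroth_point_gt0 d : (forall k, (1 < d k)%N) -> 0 < luroth_point d <= 1.
Proof.
move=> d2; have /andP[h ->] := luroth_point_itv d2; rewrite andbT.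
by apply: lt_le_trans h; rewrite invr_gt0 ltr0n ltnW.
Qed.

Lemma iter_luroth_point d n : (forall k, (1 < d k)%N) ->
  iter n luroth_map (luroth_point d) = luroth_point (d \o addn n).
Proof.
move=> d2; elim: n => [|n IH]; first by [].
rewrite iterS IH luroth_point_branch; last by move=> k; exact: d2.
rewrite luroth_map_branch//=; last by apply: luroth_point_gt0 => k; exact: d2.
by congr luroth_point; apply: funext => k /=; rewrite addnS.
Qed.

Lemma digit_luroth_point d n : (forall k, (1 < d k)%N) ->
  digit (iter n luroth_map (luroth_point d)) = d n.
Proof.
move=> d2; rewrite iter_luroth_point// luroth_point_branch; last by move=> k; exact: d2.
by rewrite digit_branch//= ?addn0//; apply: luroth_point_gt0 => k; exact: d2.
Qed.

Lemma luroth_pointB d e n : (forall k, (1 < d k)%N) -> (forall k, (1 < e k)%N) ->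
  (forall k, (k < n)%N -> d k = e k) ->
  luroth_point d - luroth_point e =
    (luroth_point (d \o addn n) - luroth_point (e \o addn n)) *
      \prod_(k < n) ((d k)%:R * ((d k)%:R - 1))^-1.
Proof.
elim: n d e => [|n IH] d e d2 e2 de; first by rewrite big_ord0 mulr1.
rewrite luroth_point_branch// (luroth_point_branch e2) -(de 0%N)// branchB.
rewrite (IH (d \o succn) (e \o succn)); last 3 first.
- by move=> k; exact: d2.
- by move=> k; exact: e2.
- by move=> k kn; apply: (de k.+1).
by rewrite big_ord_recl/= -!mulrA; congr (_ * _); rewrite mulrC.
Qed.

End LurothPoint.

(** * Expansions of points along prescribed digit weights *)

Section Expansion.
Context {R : realType}.
Variables (m : nat -> nat) (w : nat -> nat -> R).
Hypothesis w_gt0 : forall n i, (i < m n)%N -> 0 < w n i.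
Hypothesis w_sum : forall n, \sum_(i < m n) w n i = 1.

Definition weight_sum n i : R := \sum_(j < i) w n j.

Lemma expansion_index_ex n (y : R) : 0 < y <= 1 ->
  exists i, (i < m n)%N && (weight_sum n i < y <= weight_sum n i.+1).
Proof.
move=> /andP[y0 y1].
have ex : exists i, y <= weight_sum n i.
  by exists (m n); rewrite /weight_sum w_sum.
case: (ex_minnP ex) => -[|i] yi imin; first by rewrite /weight_sum big_ord0 leNgt y0 in yi.
exists i; rewrite yi andbT; apply/andP; split.
  by apply: imin; rewrite /weight_sum w_sum.
by rewrite ltNge; apply/negP => /imin; rewrite ltnn.
Qed.

Definition expansion_index n (y : R) : nat :=
  xget 0%N [set i | (i < m n)%N && (weight_sum n i < y <= weight_sum n i.+1)].

Lemma expansion_indexP n (y : R) : 0 < y <= 1 -> (expansion_index n y < m n)%N /\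
  weight_sum n (expansion_index n y) < y <= weight_sum n (expansion_index n y).+1.
Proof.
move=> /(expansion_index_ex n)[i iP]; rewrite /expansion_index.
by case: xgetP => [j -> /= /andP[]//|/(_ i)].
Qed.

(** Stage n cuts (0, 1] into cells of lengths [w n i], and the cell containing the current point is
    stretched back to (0, 1]. Points sharing their first n digits thus fill an interval whose length
    is the product of the weights. *)
Fixpoint expansion_orbit n (y : R) : R :=
  if n is n'.+1 then
    let z := expansion_orbit n' y in
    (z - weight_sum n' (expansion_index n' z)) / w n' (expansion_index n' z)
  else y.

Lemma expansion_orbit_itv n (y : R) : 0 < y <= 1 -> 0 < expansion_orbit n y <= 1.
Proof.
move=> y01; elim: n => //= n IH; move: (expansion_orbit n y) IH => z z01.
have [im /andP[h1 h2]] := expansion_indexP n z01.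
rewrite divr_gt0 ?subr_gt0 ?w_gt0//= ler_pdivrMr ?w_gt0// mul1r.
by rewrite lerBlDl; apply: le_trans h2 _; rewrite /weight_sum big_ord_recr.
Qed.

Definition expansion_digit n y := expansion_index n (expansion_orbit n y).

Lemma expansion_orbitB n (y z : R) : 0 < y <= 1 -> 0 < z <= 1 ->
  (forall k, (k < n)%N -> expansion_digit k y = expansion_digit k z) ->
  y - z = (\prod_(k < n) w k (expansion_digit k y)) *
    (expansion_orbit n y - expansion_orbit n z).
Proof.
move=> y01 z01; elim: n => [|n IH] yz; first by rewrite big_ord0 mul1r.
rewrite IH => [|k kn]; last by apply: yz; exact: ltnW.
rewrite big_ord_recr/= -/(expansion_digit n y) -/(expansion_digit n z) -yz//.
rewrite -!mulrA; congr (_ * _).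
have w0 : 0 < w n (expansion_digit n y).
  by apply: w_gt0; apply: (expansion_indexP n (expansion_orbit_itv n y01)).1.
by field; rewrite gt_eqF.
Qed.

End Expansion.

(* [W n y <= tau n * len n y ^ s] where [W] is the product of the weights and
   [len] the cylinder length. In [w_block], [w n] summed from [i] to [i'] bounds
   the distance of two points whose expansions first differ at position [n]; the
   second alternative exploits the cylinders lying strictly between them, the
   first one only the gap left by the bounded next digit. *)
Section CantorSet.
Context {R : realType}.
Variables (lo m : nat -> nat) (w : nat -> nat -> R) (tau : nat -> R) (s K C : R).
Hypothesis s_ge0 : 0 <= s.
Hypothesis K_gt0 : 0 < K.
Hypothesis C_gt0 : 0 < C.
Hypothesis lo_ge2 : forall n, (1 < lo n)%N.
Hypothesis w_gt0 : forall n i, (i < m n)%N -> 0 < w n i.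
Hypothesis w_sum : forall n, \sum_(i < m n) w n i = 1.
Hypothesis tau0 : 1 <= tau 0%N.
Hypothesis tauS : forall n i, (i < m n)%N ->
  tau n * (w n i * ((lo n + i)%:R * ((lo n + i)%:R - 1)) `^ s) <= tau n.+1.
Hypothesis tauC : forall n, tau n * (lo n + m n)%:R `^ s <= C.
Hypothesis w_block : forall n i i', (i < i')%N -> (i' < m n)%N ->
  \sum_(i <= j < i'.+1) w n j <= K * w n i \/
  (i.+1 < i')%N /\
  \sum_(i <= j < i'.+1) w n j <= K * ((i' - i.+1)%:R / (lo n + m n)%:R ^+ 2) `^ s
    * (lo n + m n)%:R `^ s.

Let idx n (y : R) := expansion_digit m w n y.
Let dig y n := (lo n + idx n y)%N.
Let W n y := \prod_(k < n) w k (idx k y).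
Let len n y : R := \prod_(k < n) ((dig y k)%:R * ((dig y k)%:R - 1))^-1.

Let idx_lt n (y : R) : 0 < y <= 1 -> (idx n y < m n)%N.
Proof. by move=> y01; case: (expansion_indexP w_sum n (expansion_orbit_itv w_gt0 w_sum n y01)). Qed.

Let dig_gt1 y n : (1 < dig y n)%N.
Proof. exact: leq_trans (lo_ge2 n) (leq_addr _ _). Qed.

Let cyl_gt0 y n : 0 < ((dig y n)%:R * ((dig y n)%:R - 1)) :> R.
Proof. by rewrite mulr_gt0 ?subr_gt0 ?ltr1n ?dig_gt1// ltr0n ltnW ?dig_gt1. Qed.

Let len_gt0 n y : 0 < len n y.
Proof. by apply: prodr_gt0 => k _; rewrite invr_gt0 cyl_gt0. Qed.

Let len_le n y : len n y <= 2^-1 ^+ n.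
Proof.
rewrite -[n in leRHS]card_ord -prodr_const; apply: ler_prod => k _.
rewrite invr_ge0 (ltW (cyl_gt0 _ _))/= lef_pV2 ?posrE ?cyl_gt0//.
have : 2 <= (dig y k)%:R :> R by rewrite ler_nat dig_gt1.
by nra.
Qed.

Let hi_gt0 n : 0 < (lo n + m n)%:R :> R.
Proof. by rewrite ltr0n addn_gt0 ltnW. Qed.

Let tau_gt0 n : 0 < tau n.
Proof.
elim: n => [|n IH]; first exact: lt_le_trans ltr01 tau0.
have m0 : (0 < m n)%N.
  case: (m n) (w_sum n) => // /eqP; by rewrite big_ord0 eq_sym oner_eq0.
apply: lt_le_trans (tauS m0); rewrite mulr_gt0// mulr_gt0 ?w_gt0 ?powR_gt0//.
by rewrite mulr_gt0 ?subr_gt0 ?ltr1n ?ltr0n ?addn0 ?lo_ge2// ltnW.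
Qed.

Let W_le n (y : R) : 0 < y <= 1 -> W n y <= tau n * len n y `^ s.
Proof.
move=> y01; elim: n => [|n IH]; first by rewrite /W /len !big_ord0 powR1 mulr1.
rewrite /W big_ord_recr/= -/(W n y).
have w0 := w_gt0 (idx_lt n y01).
apply: (@le_trans _ _ (tau n * len n y `^ s * w n (idx n y))); first by rewrite ler_pM2r.
rewrite /len big_ord_recr/= -/(len n y) powRM ?invr_ge0 ?(ltW (cyl_gt0 _ _)) ?(ltW (len_gt0 _ _))//.
rewrite powRV ?(ltW (cyl_gt0 _ _))// mulrA ler_pdivlMr ?powR_gt0 ?cyl_gt0//.
rewrite -!mulrA mulrCA [leRHS]mulrC; apply: ler_wpM2l; first exact: powR_ge0.
exact: tauS (idx_lt n y01).
Qed.

Let W_ge0 n (y : R) : 0 < y <= 1 -> 0 < W n y.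
Proof. by move=> y01; apply: prodr_gt0 => k _; apply: w_gt0; exact: idx_lt. Qed.

(** If all digits agreed, |y - z| would be at most [W n y], hence at most C 2^(- s n) for every n,
    forcing y = z. *)
Let digit_ex (y z : R) : 0 < s -> 0 < y <= 1 -> 0 < z <= 1 -> y != z ->
  exists n, (forall k, (k < n)%N -> idx k y = idx k z) /\ idx n y != idx n z.
Proof.
move=> s0 y01 z01 yz.
have ex : exists n, idx n y != idx n z.
  apply: contrapT => nex.
  have E k : idx k y = idx k z by apply/eqP/negPn/negP => h; apply: nex; exists k.
  have B n : `|y - z| <= C * (2^-1 `^ s) ^+ n.
    rewrite (expansion_orbitB w_gt0 w_sum (n := n) y01 z01 (fun k _ => E k)).
    rewrite normrM -/(W n y) (ger0_norm (ltW (W_ge0 n y01))).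
    have o1 := expansion_orbit_itv w_gt0 w_sum n y01.
    have o2 := expansion_orbit_itv w_gt0 w_sum n z01.
    apply: (@le_trans _ _ (W n y)).
      rewrite ler_piMr ?(ltW (W_ge0 n y01))//.
      by rewrite ler_norml; case/andP: o1; case/andP: o2; lra.
    apply: (le_trans (W_le n y01)); apply: ler_pM; rewrite ?powR_ge0 ?(ltW (tau_gt0 _))//.
      apply: le_trans (tauC n); rewrite ler_peMr ?(ltW (tau_gt0 _))//.
      rewrite -[leLHS](powRr0 ((lo n + m n)%:R : R)) ler_powR//.
      by rewrite ler1n addn_gt0 ltnW.
    by rewrite -powRXn ?invr_ge0//; apply: le_powR; rewrite ?(ltW (len_gt0 _ _)).
  have r1 := half_powR_lt1 s0.
  have h2 : C * (2^-1 `^ s : R) ^+ n @[n --> \oo] --> C * (0 : R).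
    by apply: cvgMr; apply: cvg_expr; rewrite ger0_norm ?powR_ge0.
  rewrite mulr0 in h2.
  have yz0 : 0 < `|y - z| by rewrite normr_gt0 subr_eq0.
  have [N HN] := cvgn0_near h2 yz0.
  have := HN N (leqnn _); rewrite ltNge; apply/negP/negPn.
  by apply: le_trans (B N) (ler_norm _).
exists (ex_minn ex); case: ex_minnP => n nP nmin; split => // k kn.
by apply/eqP/negPn/negP => /nmin; rewrite leqNgt kn.
Qed.

(** At the first differing position the larger digit gives the smaller Lüroth point. The gap [A] is
    bounded below in two ways, one for each alternative of [w_block]. *)
Let holder_lt (y z : R) n : 0 < y <= 1 -> 0 < z <= 1 ->
  (forall k, (k < n)%N -> idx k y = idx k z) -> (idx n y < idx n z)%N ->
  `|y - z| <= K * C * `|luroth_point (dig y) - luroth_point (dig z)| `^ s.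
Proof.
move=> y01 z01 yz lt.
rewrite (@luroth_pointB R (dig y) (dig z) n) //; last by move=> k kn; rewrite /dig yz.
rewrite -/(len n y).
set A := (X in K * C * `|X| `^ s).
set a := dig y n; set b := dig z n.
have a1 : (1 < a)%N := dig_gt1 y n.
have b1 : (1 < b)%N := dig_gt1 z n.
have ab : (a < b)%N by rewrite ltn_add2l.
have bhi : (b < lo n + m n)%N by rewrite ltn_add2l idx_lt.
have aR : 1 < a%:R :> R by rewrite ltr1n.
have bR : a%:R + 1 <= b%:R :> R by rewrite natr1 ler_nat.
have pa := luroth_point_itv (d := dig y \o addn n.+1) (fun k => dig_gt1 y _) (R := R).
have pb := luroth_point_gt0 (d := dig z \o addn n.+1) (fun k => dig_gt1 z _) (R := R).
have EA : A = (a%:R^-1 + luroth_point (dig y \o addn n.+1) / (a%:R * (a%:R - 1)) -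
               (b%:R^-1 + luroth_point (dig z \o addn n.+1) / (b%:R * (b%:R - 1)))) * len n y.
  rewrite /A luroth_point_branch; last by move=> k; exact: dig_gt1.
  rewrite (@luroth_point_branch R (dig z \o addn n)); last by move=> k; exact: dig_gt1.
  rewrite /branch /= !addn0 -/a -/b.
  have sh t : (dig t \o addn n) \o succn = dig t \o addn n.+1.
    by apply: funext => k /=; rewrite addnS.
  by rewrite !sh.
have bb : b%:R^-1 + luroth_point (dig z \o addn n.+1) / (b%:R * (b%:R - 1)) <= (b%:R - 1)^-1 :> R.
  apply: (@le_trans _ _ (b%:R^-1 + 1 / (b%:R * (b%:R - 1)))).
    rewrite lerD2l ler_pM2r; first by case/andP: pb.
    by rewrite invr_gt0 mulr_gt0//; lra.
  rewrite le_eqVlt; apply/orP; left; apply/eqP; field.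
  by rewrite !gt_eqF//; lra.
(* Relative to the common cylinder, the point with digit b is at most 1/(b - 1) <= 1/a; what remains
   is the height of the other point above 1/a. *)
have A1 : luroth_point (dig y \o addn n.+1) / (a%:R * (a%:R - 1)) * len n y <= A.
  rewrite EA ler_pM2r ?len_gt0//.
  have : (b%:R - 1)^-1 <= a%:R^-1 :> R by rewrite lef_pV2 ?posrE; lra.
  by lra.
(* The cylinders of the digits strictly between a and b have total length 1/a - 1/(b - 1). *)
have A2 : (a%:R^-1 - (b%:R - 1)^-1) * len n y <= A.
  rewrite EA ler_pM2r ?len_gt0//.
  have : 0 <= luroth_point (dig y \o addn n.+1) / (a%:R * (a%:R - 1)) :> R.
    rewrite divr_ge0//; last by rewrite mulr_ge0//; lra.
    by case/andP: pa => + _; apply: le_trans; rewrite invr_ge0.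
  by lra.
(* Both points lie in the stage-n cells from [idx n y] to [idx n z], shrunk by the common factor
   [W n y]. *)
have yzW : `|y - z| <= W n y * \sum_(idx n y <= j < (idx n z).+1) w n j.
  rewrite (expansion_orbitB w_gt0 w_sum y01 z01 yz) normrM -/(W n y).
  rewrite (ger0_norm (ltW (W_ge0 n y01))) ler_pM2l ?W_ge0//.
  have [_ ] := expansion_indexP w_sum n (expansion_orbit_itv w_gt0 w_sum n y01).
  have [_ ] := expansion_indexP w_sum n (expansion_orbit_itv w_gt0 w_sum n z01).
  rewrite -/(expansion_digit m w n y) -/(expansion_digit m w n z).
  rewrite -/(idx n y) -/(idx n z) => /andP[z1 z2] /andP[y1 y2].
  have E : \sum_(idx n y <= j < (idx n z).+1) w n j =
      weight_sum w n (idx n z).+1 - weight_sum w n (idx n y).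
    apply/esym/eqP; rewrite subr_eq addrC /weight_sum -!(big_mkord xpredT).
    by rewrite -(big_cat_nat (n := idx n y))//= ltnW// ltnW.
  have mono : weight_sum w n (idx n y).+1 <= weight_sum w n (idx n z).
    rewrite /weight_sum -!(big_mkord xpredT (w n)).
    rewrite (big_cat_nat (n := (idx n y).+1) (p := idx n z))//=.
    rewrite lerDl big_nat_cond sumr_ge0// => j /andP[/andP[_ jz] _].
    by rewrite ltW// w_gt0// (ltn_trans jz)// idx_lt.
  by rewrite E ler_norml; apply/andP; split; lra.
have A0 : 0 <= A.
  apply: le_trans A1; rewrite mulr_ge0 ?(ltW (len_gt0 _ _))// divr_ge0//.
    by case/andP: pa => + _; apply: le_trans; rewrite invr_ge0.
  by rewrite mulr_ge0//; lra.
rewrite (ger0_norm A0); apply: (le_trans yzW).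
have [cse|[ii cse]] := w_block lt (idx_lt n z01).
(* The tail of the first point is at least the reciprocal of its next digit, hence of
   [lo n.+1 + m n.+1]; [tauC] at n + 1 pays for this loss. *)
- apply: (@le_trans _ _ (K * W n.+1 y)).
    rewrite /W big_ord_recr/= -/(W n y) mulrCA ler_pM2l ?W_ge0//.
  rewrite -mulrA ler_pM2l//; apply: (le_trans (W_le _ y01)).
  have h0 := hi_gt0 n.+1.
  apply: (@le_trans _ _ (C * (len n.+1 y / (lo n.+1 + m n.+1)%:R) `^ s)).
    rewrite powRM ?(ltW (len_gt0 _ _)) ?invr_ge0 ?(ltW h0)// powRV ?(ltW h0)//.
    rewrite [leRHS]mulrCA [leLHS]mulrC ler_pM2l ?powR_gt0 ?len_gt0//.
    by rewrite ler_pdivlMr ?powR_gt0.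
  rewrite ler_pM2l//; apply: le_powR => //.
    by rewrite divr_ge0 ?(ltW (len_gt0 _ _)) ?(ltW h0).
  apply: le_trans A1; rewrite /len big_ord_recr/= -/(len n y) -/a.
  rewrite [leRHS]mulrC -mulrA ler_pM2l ?len_gt0// mulrC ler_pM2r; last first.
    by rewrite invr_gt0 mulr_gt0//; lra.
  case/andP: pa => + _; apply: le_trans => /=.
  rewrite lef_pV2 ?posrE//; last by rewrite ltr0n addn0 ltnW// dig_gt1.
  by rewrite ler_nat addn0 leq_add2l ltnW// idx_lt.
(* Both a and b - 1 are below [lo n + m n], so [q] bounds the intermediate cylinders from below;
   [tauC] at n absorbs the other factor. *)
- have h0 := hi_gt0 n.
  rewrite (le_trans (ler_wpM2l (ltW (W_ge0 n y01)) cse))//.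
  rewrite -!mulrA mulrCA ler_pM2l//.
  set q := (_%:R / _ ^+ 2).
  have q0 : 0 <= q by rewrite divr_ge0// exprn_ge0 ?(ltW h0).
  apply: (@le_trans _ _ (C * (len n y * q) `^ s)).
    apply: (@le_trans _ _ (tau n * len n y `^ s * (q `^ s * (lo n + m n)%:R `^ s))).
      by rewrite ler_wpM2r ?W_le// mulr_ge0 ?powR_ge0.
    rewrite powRM ?(ltW (len_gt0 _ _))//.
    rewrite (_ : _ * _ = tau n * (lo n + m n)%:R `^ s * (len n y `^ s * q `^ s)); last by ring.
    by rewrite ler_wpM2r// mulr_ge0 ?powR_ge0.
  rewrite ler_pM2l//; apply: le_powR => //; first by rewrite mulr_ge0 ?(ltW (len_gt0 _ _)).
  apply: le_trans A2; rewrite mulrC ler_pM2r ?len_gt0//.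
  have -> : a%:R^-1 - (b%:R - 1)^-1 = (b%:R - 1 - a%:R) / (a%:R * (b%:R - 1)) :> R.
    by field; rewrite !gt_eqF//; lra.
  have E : (idx n z - (idx n y).+1)%:R = b%:R - 1 - a%:R :> R.
    rewrite natrB//  -natr1 /a /b /dig !natrD; ring.
  have bh : b%:R <= (lo n + m n)%:R :> R by rewrite ler_nat ltnW.
  rewrite /q E; apply: ler_wpM2l; first by lra.
  by rewrite lef_pV2 ?posrE ?exprn_gt0// ?mulr_gt0//; nra.
Qed.

(** The map from y to its Lüroth point has a Hölder inverse of exponent s, as seen by comparing two
    points at their first differing digit. *)
Lemma hausdorff_dim_ge_digits (E : set R) : 0 < s ->
  (forall x, 0 < x <= 1 ->
    (forall n, (lo n <= digit (iter n luroth_map x) < lo n + m n)%N) -> E x) ->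
  (s%:E <= hausdorff_dim E)%E.
Proof.
move=> s0 HE; apply: (@hausdorff_dim_ge_holder R E s (K * C) (fun y => luroth_point (dig y))) => //.
- exact: mulr_gt0.
- move=> y y01; apply: HE => [|n]; first exact: luroth_point_gt0.
  by rewrite digit_luroth_point// leq_addr ltn_add2l idx_lt.
move=> y z y01 z01; have [->|yz] := eqVneq y z.
  by rewrite subrr normr0 mulr_ge0 ?powR_ge0// mulr_ge0// ltW.
have [n [yzn]] := digit_ex s0 y01 z01 yz; rewrite neq_ltn => /orP[lt|lt].
  exact: (holder_lt y01 z01 yzn lt).
rewrite distrC [X in X `^ s]distrC; apply: (holder_lt (n := n)) => // k kn.
by rewrite yzn.
Qed.

End CantorSet.

(** * Digits distributed uniformly on blocks [N, 2N) *)

Section LowerBounds.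
Context {R : realType}.
Implicit Types (psi : nat -> R).

Lemma expr_ge_near (b A : R) : 1 < b -> exists N, forall n, (N <= n)%N -> A <= b ^+ n.
Proof.
move=> b1; have b0 : 0 < b by apply: lt_trans b1.
have h : b^-1 ^+ n @[n --> \oo] --> (0 : R).
  by apply: cvg_expr; rewrite gtr0_norm ?invr_gt0// invf_lt1.
have A0 : 0 < `|A| + 1 by rewrite ltr_wpDl.
have iA0 : 0 < (`|A| + 1)^-1 by rewrite invr_gt0.
have [N HN] := cvgn0_near h iA0; exists N => n /HN.
rewrite ger0_norm ?exprn_ge0 ?invr_ge0 ?(ltW b0)//.
rewrite exprVn ltf_pV2 ?posrE ?exprn_gt0// => /ltW; apply: le_trans.
by apply: le_trans (ler_norm _) _; rewrite lerDl.
Qed.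

Lemma natr_ge_near (x : R) : exists N, forall n, (N <= n)%N -> x <= n%:R.
Proof.
exists (Num.truncn x).+1 => n Nn; apply: le_trans (ltW (truncnS_gt x)) _.
by rewrite ler_nat.
Qed.

(* Digit n+1 of x is [digit (iter n luroth_map x)]. *)
Lemma E_supP psi (x B : R) : (forall n : nat, (0 < n)%N -> 0 < psi n) ->
  psi n @[n --> \oo] --> +oo -> 0 < x <= 1 ->
  (forall n, ln (digit (iter n luroth_map x))%:R <= psi n.+1 + B) ->
  (forall N, exists2 n, (N <= n)%N & psi n.+1 <= ln (digit (iter n luroth_map x))%:R) ->
  E_sup psi x.
Proof.
move=> psi0 psioo x01 ub lb; split; first by rewrite in_itv.
apply/eqP; rewrite eq_le; apply/andP; split.
  apply/lee_addgt0Pr => e e0.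
  have [N HN] := cvgny_near psioo (B / e).
  apply: (@limn_esup_le_near R _ _ N.+1) => -[//|n] Nn.
  rewrite luroth_digitE// -EFinD lee_fin ler_pdivrMr ?psi0//.
  apply: (le_trans (ub n)); have := HN n.+1 (ltnW Nn).
  by rewrite ler_pdivrMr// mulrDl mul1r lerD2l mulrC.
apply: limn_esup_ge_often => N; have [n Nn Hn] := lb N.
exists n.+1; first exact: leqW.
by rewrite luroth_digitE// lee_fin ler_pdivlMr ?psi0// mul1r.
Qed.

(** The least natural number above e^c. For c > 0 a digit in [N, 2N) has logarithm in [c, c + ln 4],
    a bounded error that disappears after division by [psi]. *)
Definition block_start (c : R) : nat := (Num.truncn (expR c)).+1.

Lemma block_start_itv c : 0 < c -> expR c <= (block_start c)%:R <= 2 * expR c.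
Proof.
move=> c0; rewrite /block_start; have e1 : 1 < expR c by rewrite expR_gt1.
have /andP[h1 h2] := truncn_itv (ltW (expR_gt0 c)).
by rewrite (ltW h2)/= -natr1; lra.
Qed.

Lemma block_start_ge2 c : 0 < c -> (1 < block_start c)%N.
Proof.
move=> c0; rewrite -(ltr1n R); have /andP[+ _] := block_start_itv c0.
by apply: lt_le_trans; rewrite expR_gt1.
Qed.

Lemma ln_block c d : 0 < c -> (block_start c <= d < block_start c + block_start c)%N ->
  c <= ln (d%:R : R) <= c + ln 4.
Proof.
move=> c0 /andP[h1 h2]; have /andP[b1 b2] := block_start_itv c0.
have d0 : expR c <= d%:R by apply: le_trans b1 _; rewrite ler_nat.
have d1 : d%:R <= 4 * expR c.
  apply: (@le_trans _ _ (block_start c + block_start c)%:R); first by rewrite ler_nat ltnW.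
  by rewrite natrD; lra.
have e0 := expR_gt0 c; have dp : 0 < d%:R :> R := lt_le_trans e0 d0.
rewrite -[X in X <= _ <= _]expRK -[X in X + _]expRK addrC -lnM ?posrE//.
by rewrite !ler_ln ?posrE ?mulr_gt0// d0.
Qed.

(** Adjacent indices carry total weight 2/N. Otherwise j = i' - i - 1 >= 1 and the sum is (j + 2)/N
    <= 3 j/N = 6 (j/(2 N)), where j/(2 N) <= 1 is at most its own s-th power; hence the constant
    6. *)
Lemma uniform_block (s K : R) (N i i' : nat) : 0 <= s <= 1 -> 6 <= K ->
  (i < i')%N -> (i' < N)%N ->
  \sum_(i <= j < i'.+1) N%:R^-1 <= K * N%:R^-1 \/
  (i.+1 < i')%N /\
  \sum_(i <= j < i'.+1) N%:R^-1 <= K * ((i' - i.+1)%:R / (N + N)%:R ^+ 2) `^ s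
    * (N + N)%:R `^ s.
Proof.
move=> /andP[s0 s1] K6 ii iN; have N0 : 0 < N%:R :> R by rewrite ltr0n (leq_ltn_trans _ iN).
rewrite sumr_const_nat -[_ *+ _]mulr_natl.
have [ii1|ii1] := leqP i' i.+1.
  left; rewrite ler_pM2r ?invr_gt0//; apply: le_trans K6.
  have -> : i' = i.+1 by apply/eqP; rewrite eqn_leq ii1.
  by rewrite subSn ?leqnSn// subSnn ler_nat.
right; split=> //.
have j1 : 1 <= (i' - i.+1)%:R :> R by rewrite ler1n subn_gt0.
have E : (i'.+1 - i)%:R = (i' - i.+1)%:R + 2 :> R.
  by rewrite -natrD; congr (_%:R); lia.
have jN : (i' - i.+1)%:R <= N%:R :> R by rewrite ler_nat; lia.
move: j1 E jN; set j := (i' - i.+1)%:R => j1 -> jN.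
have NN : (N + N)%:R = 2 * N%:R :> R by rewrite natrD mulr2n mulrDl mul1r.
rewrite -mulrA -powRM ?divr_ge0 ?exprn_ge0//.
rewrite NN (_ : _ * (2 * N%:R) = j / (2 * N%:R)); last by field; rewrite gt_eqF.
apply: (@le_trans _ _ (6 * (j / (2 * N%:R)))).
  rewrite (_ : 6 * _ = 3 * j / N%:R); last by field; rewrite gt_eqF.
  by rewrite ler_pM2r ?invr_gt0//; lra.
have q0 : 0 < j / (2 * N%:R) by rewrite divr_gt0 ?mulr_gt0//; lra.
apply: ler_pM => //; first exact: ltW.
apply: ger1_powR => //; rewrite q0/= ler_pdivrMr ?mulr_gt0//; lra.
Qed.

Lemma block_weight_le (s : R) (N d : nat) : 0 <= s -> (0 < d)%N -> (d < N + N)%N ->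
  N%:R^-1 * (d%:R * (d%:R - 1)) `^ s <= 4 `^ s * (N%:R ^+ 2) `^ s / N%:R.
Proof.
move=> s0 d0 dN; rewrite mulrC ler_wpM2r ?invr_ge0//.
have d1 : 1 <= d%:R :> R by rewrite ler1n.
have dN' : d%:R <= 2 * N%:R :> R by rewrite mulr2n mulrDl mul1r -natrD ler_nat ltnW.
rewrite -powRM ?exprn_ge0//; apply: le_powR => //; first by rewrite mulr_ge0//; lra.
nra.
Qed.

(** The product is the distortion [tau] for weights 1/N: each factor bounds the weight divided by
    the s-th power of the one-digit cylinder length. *)
Lemma hausdorff_dim_ge_blocks (E : set R) (N : nat -> nat) (s C : R) :
  0 < s <= 1 -> (forall n, (1 < N n)%N) ->
  (forall n, (\prod_(j < n) (4 `^ s * ((N j)%:R ^+ 2) `^ s / (N j)%:R)) *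
     (N n + N n)%:R `^ s <= C) ->
  (forall x, 0 < x <= 1 ->
    (forall n, (N n <= digit (iter n luroth_map x) < N n + N n)%N) -> E x) ->
  (s%:E <= hausdorff_dim E)%E.
Proof.
move=> /andP[s0 s1] N2 NC NE.
have N0 n : 0 < (N n)%:R :> R by rewrite ltr0n ltnW.
have C0 : 0 < C.
  apply: lt_le_trans (NC 0%N); rewrite big_ord0 mul1r powR_gt0// natrD.
  by have := N0 0%N; lra.
apply: (@hausdorff_dim_ge_digits R N N (fun n _ => (N n)%:R^-1)
  (fun n => \prod_(j < n) (4 `^ s * ((N j)%:R ^+ 2) `^ s / (N j)%:R)) s 6 C) => //.
- exact: ltW.
- by move=> n i _; rewrite invr_gt0.
- move=> n; rewrite sumr_const card_ord -[_ *+ _]mulr_natr mulVf//.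
  by rewrite gt_eqF.
- by rewrite big_ord0.
- move=> n i iN; rewrite big_ord_recr/=; apply: ler_wpM2l.
    by apply: prodr_ge0 => j _; rewrite !mulr_ge0 ?powR_ge0 ?invr_ge0.
  apply: block_weight_le; [exact: ltW| |by rewrite ltn_add2l].
  by rewrite addn_gt0 ltnW.
- by move=> n i i' ii iN; apply: uniform_block; rewrite ?(ltW s0).
Qed.

End LowerBounds.

(** * Digit sizes of capped geometric growth *)

Section GrowingDigits.
Context {R : realType}.
Implicit Types (psi : nat -> R).

Lemma sum_eventually_npos_ubound (t : nat -> R) (N : nat) :
  (forall n, (N <= n)%N -> t n <= 0) -> exists B, forall n, \sum_(j < n) t j <= B.
Proof.
move=> tN; exists (\sum_(j < N) `|t j|) => n.
have H k : \sum_(j < k) t j <= \sum_(j < k | (j < N)%N) `|t j|.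
  rewrite [leRHS]big_mkcond/=; apply: ler_sum => j _.
  by case: ltnP => [_|/tN//]; exact: ler_norm.
apply: (le_trans (H n)).
have [nN|Nn] := leqP n N.
  rewrite (big_ord_widen_cond N (fun j => j < N)%N (fun j => `|t j|) nN).
  by rewrite big_mkcond/=; apply: ler_sum => j _; case: ifP.
by rewrite -(big_ord_widen n (fun j => `|t j|) (ltnW Nn)).
Qed.

Variables (phi : nat -> R) (b : R).
Hypothesis phi_gt0 : forall n, 0 < phi n.
Hypothesis b_gt1 : 1 < b.

(** The largest sequence below [phi] that grows by at most the factor [b] per step; this cap lets
    the earlier digits pay for the next one. *)
Fixpoint capped_growth n : R :=
  if n is n'.+1 then Num.min (phi n) (b * capped_growth n') else phi 0%N.

#[local] Arguments capped_growth : simpl never.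

Lemma capped_growthS n : capped_growth n.+1 = Num.min (phi n.+1) (b * capped_growth n).
Proof. by []. Qed.

Let b_gt0 : 0 < b. Proof. exact: lt_trans b_gt1. Qed.

Lemma capped_growth_gt0 n : 0 < capped_growth n.
Proof.
elim: n => [|n IH]; first exact: phi_gt0.
by rewrite capped_growthS lt_min phi_gt0/= mulr_gt0.
Qed.

Lemma capped_growth_le n : capped_growth n <= phi n.
Proof. by case: n => // n; rewrite capped_growthS ge_min lexx. Qed.

Lemma capped_growthS_le n : capped_growth n.+1 <= b * capped_growth n.
Proof. by rewrite capped_growthS ge_min lexx orbT. Qed.

(** Telescoping of c_(j+1) - c_j <= (b - 1) c_j. *)
Lemma capped_growth_sum n :
  capped_growth n - capped_growth 0%N <= (b - 1) * \sum_(j < n) capped_growth j.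
Proof.
elim: n => [|n IH]; first by rewrite big_ord0 mulr0 subrr.
by rewrite big_ord_recr/=; have := capped_growthS_le n; lra.
Qed.

(** Once [phi] stays above Q, the sequence gains a factor [b] at each step until it passes Q, and
    does not fall below Q again. *)
Lemma capped_growth_near : (forall M, exists N, forall n, (N <= n)%N -> M <= phi n) ->
  forall Q, exists N, forall n, (N <= n)%N -> Q <= capped_growth n.
Proof.
move=> phioo Q0; pose Q := Num.max Q0 0.
have Qge0 : 0 <= Q by rewrite le_max lexx orbT.
have [N HN] := phioo Q.
have [k0 Hk0] := expr_ge_near (Q / capped_growth N) b_gt1.
have H k : Num.min Q (b ^+ k * capped_growth N) <= capped_growth (N + k).
  elim: k => [|k IH]; first by rewrite addn0 expr0 mul1r ge_min lexx orbT.
  rewrite addnS capped_growthS le_min; apply/andP; split.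
    by rewrite ge_min HN// -addnS leq_addr.
  apply: (@le_trans _ _ (b * Num.min Q (b ^+ k * capped_growth N))); last by rewrite ler_pM2l.
  rewrite minr_pMr ?(ltW b_gt0)// le_min !ge_min exprS mulrA lexx orbT andbT.
  by rewrite ler_peMl// ltW.
exists (N + k0)%N => n Nn.
have nE : n = (N + (n - N))%N by rewrite subnKC// (leq_trans _ Nn)// leq_addr.
rewrite nE; apply: le_trans (H _); rewrite le_min; apply/andP; split.
  by rewrite le_max lexx.
apply: (@le_trans _ _ Q); first by rewrite le_max lexx.
rewrite -ler_pdivrMr ?capped_growth_gt0//; apply: Hk0.
by rewrite leq_subRL// (leq_trans _ Nn)// leq_addr.
Qed.

(** If [phi] were not attained beyond N, the sequence would be exactly geometric of ratio [b] and
    would overtake the bound e^(beta (n + 1)) that [phi n] satisfies infinitely often. *)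
Lemma capped_growth_eq_often (beta : R) : beta < ln b ->
  (forall N, exists2 n, (N <= n)%N & ln (phi n) <= beta * n.+1%:R) ->
  forall N, exists2 n, (N <= n)%N & capped_growth n = phi n.
Proof.
move=> bb often N; apply: contrapT => H.
have E k : capped_growth (N + k) = b ^+ k * capped_growth N.
  elim: k => [|k IH]; first by rewrite addn0 mul1r.
  have : capped_growth (N + k).+1 <> phi (N + k).+1.
    by move=> E; apply: H; exists (N + k).+1 => //; rewrite -addnS leq_addr.
  rewrite addnS capped_growthS IH exprS -mulrA; case: (leP (phi _)) => // _ /eqP.
pose D := ln b - beta; have D0 : 0 < D by rewrite subr_gt0.
have [n1 Hn1] := natr_ge_near ((beta + N%:R * ln b - ln (capped_growth N) + 1) / D).
have [n + Hn] := often (maxn n1 N); rewrite geq_max => /andP[n1n Nn].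
have := Hn1 n n1n; rewrite ler_pdivrMr// /D.
have := capped_growth_le n; rewrite -(subnKC Nn) E subnKC//.
have cN := capped_growth_gt0 N.
rewrite -ler_ln ?posrE ?mulr_gt0 ?exprn_gt0//.
rewrite lnM ?posrE ?exprn_gt0// lnXn// -[ln b *+ _]mulr_natl natrB//.
by move: Hn; rewrite -natr1; lra.
Qed.

End GrowingDigits.

Section GrowingLower.
Context {R : realType}.

(** With blocks near e^(c_n), the logarithm of the distortion, last block included, is up to s ln 4
    per digit at most 2 s - 1 times the sum of the earlier c_j, plus s c_n. Bounding c_n by b - 1
    times that sum, plus a constant, leaves the coefficient s (1 + b) - 1 < 0. *)
Lemma hausdorff_dim_E_sup_ge_growing (psi : nat -> R) (b beta s : R) :
  (forall n : nat, (0 < n)%N -> 0 < psi n) -> psi n @[n --> \oo] --> +oo ->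
  1 < b -> beta < ln b ->
  (forall N, exists2 n, (N <= n)%N & ln (psi n) <= beta * n%:R) ->
  0 < s -> s * (1 + b) < 1 ->
  (s%:E <= hausdorff_dim (E_sup psi))%E.
Proof.
move=> psi0 psioo b1 bb often s0 sb.
pose phi n := psi n.+1.
have phi0 n : 0 < phi n by exact: psi0.
pose c := capped_growth phi b.
have c0 n : 0 < c n by exact: capped_growth_gt0.
have often' N : exists2 n, (N <= n)%N & ln (phi n) <= beta * n.+1%:R.
  have [[|n] Nn Hn] := often N.+1; first by [].
  by exists n.
have phioo M : exists N, forall n, (N <= n)%N -> M <= phi n.
  have [N HN] := cvgny_near psioo M.
  by exists N => n Nn; apply: HN; exact: leqW.
pose theta := 1 - s * (1 + b).
have theta0 : 0 < theta by rewrite subr_gt0.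
(* From [N0] on, [theta * c j] outweighs the constant s ln 4 contributed by each block. *)
have [N0 HN0] := capped_growth_near phi0 b1 phioo (s * ln 4 / theta).
have [B HB] : exists B, forall n, \sum_(j < n) (s * ln 4 - theta * c j) <= B.
  apply: (@sum_eventually_npos_ubound R (fun j => s * ln 4 - theta * c j) N0) => n Nn.
  by rewrite subr_le0 -ler_pdivrMl// mulrC HN0.
pose N n := block_start (c n).
have Nitv n : expR (c n) <= (N n)%:R <= 2 * expR (c n) by exact: block_start_itv.
have NR0 n : 0 < (N n)%:R :> R by case/andP: (Nitv n) => + _; apply: lt_le_trans; exact: expR_gt0.
apply: (@hausdorff_dim_ge_blocks R _ N s (expR (s * ln 4 + s * phi 0%N + B))).
- by rewrite s0/=; nra.
- by move=> n; exact: block_start_ge2.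
- move=> n.
  have step j : 4 `^ s * ((N j)%:R ^+ 2) `^ s / (N j)%:R <=
      expR (s * ln 4 + (2 * s - 1) * c j).
    have -> : 4 `^ s * ((N j)%:R ^+ 2) `^ s / (N j)%:R =
        expR (s * ln 4 + (2 * s - 1) * ln (N j)%:R).
      rewrite /powR !gt_eqF ?exprn_gt0//= lnXn// -[(N j)%:R in LHS]lnK ?posrE//.
      by rewrite -expRN -!expRD; congr expR; rewrite -mulr_natl expRK; ring.
    (* 2 s - 1 < 0 because b > 1 and s (1 + b) < 1, so the lower bound c_j <= ln N is the one that
       applies. *)
    rewrite ler_expR lerD2l; apply: ler_wnM2l; first by nra.
    rewrite -[X in X <= _]expRK ler_ln ?posrE ?expR_gt0//.
    by case/andP: (Nitv j).
  have prodle : \prod_(j < n) (4 `^ s * ((N j)%:R ^+ 2) `^ s / (N j)%:R) <=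
      expR (\sum_(j < n) (s * ln 4 + (2 * s - 1) * c j)).
    rewrite expR_sum; apply: ler_prod => j _; rewrite step andbT.
    by rewrite !mulr_ge0 ?powR_ge0 ?invr_ge0.
  have last_le : (N n + N n)%:R `^ s <= expR (s * ln 4 + s * c n).
    have -> : expR (s * ln 4 + s * c n) = (4 * expR (c n)) `^ s.
      rewrite /powR gt_eqF ?mulr_gt0 ?expR_gt0// lnM ?posrE ?expR_gt0// expRK.
      by rewrite mulrDr.
    apply: le_powR; [exact: ltW|by []|].
    by rewrite natrD; case/andP: (Nitv n); lra.
  apply: (@le_trans _ _ (expR (\sum_(j < n) (s * ln 4 + (2 * s - 1) * c j)) *
    expR (s * ln 4 + s * c n))).
    apply: ler_pM => //.
    by apply: prodr_ge0 => j _; rewrite !mulr_ge0 ?powR_ge0 ?invr_ge0.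
  rewrite -expRD ler_expR.
  have cS : c n - phi 0%N <= (b - 1) * \sum_(j < n) c j := capped_growth_sum phi b n.
  have := HB n; rewrite sumrB big_split/= -!mulr_sumr.
  move: cS; set S := \sum_(j < n) c j => cS.
  have : s * (c n - phi 0%N) <= s * ((b - 1) * S) by rewrite ler_pM2l.
  by rewrite /theta; lra.
move=> x x01 Hx; apply: (E_supP (B := ln 4)) => //.
  move=> n; have /andP[_ h] := ln_block (c0 n) (Hx n).
  by apply: (le_trans h); rewrite lerD2r; exact: capped_growth_le.
move=> M; have [n Mn En] := capped_growth_eq_often phi0 b1 bb often' M.
exists n => //; have /andP[h _] := ln_block (c0 n) (Hx n).
by move: h; rewrite /c En.
Qed.

End GrowingLower.

(** * Sparse blocks among digits from a finite alphabet *)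

Section SparseBlocks.
Context {R : realType}.
Variables (psi : nat -> R) (s alpha : R) (M : nat).

(** Its logarithm is the pressure, at exponent s, of the subsystem with digits 2, ..., M + 1. *)
Definition digit_pressure : R :=
  \sum_(k < M) ((k.+2%:R * (k.+2%:R - 1))^-1) `^ s.

(* A position becomes a block as soon as [psi] is small there and the distortion
   accumulated so far is absorbed; between blocks the distortion decays like
   [digit_pressure ^- n], which beats [e ^ (- alpha s n)], so blocks recur. *)
Definition block_at (t : R) (n : nat) : bool :=
  (psi n.+1 <= alpha * n.+1%:R) && (t * (block_start (psi n.+1))%:R `^ s <= 1).

(** Serves as [tau]. Off the blocks the weights are proportional to the s-th powers of the cylinder
    lengths, with quotient exactly 1 / [digit_pressure]; on a block the factor is the bound for
    uniform weights. *)
Fixpoint distortion n : R :=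
  if n is n'.+1 then
    let N : R := (block_start (psi n))%:R in
    if block_at (distortion n') n' then distortion n' * (4 `^ s * (N ^+ 2) `^ s / N)
    else distortion n' / digit_pressure
  else 1.

#[local] Arguments distortion : simpl never.

Lemma distortionS n : distortion n.+1 =
  if block_at (distortion n) n then distortion n *
    (4 `^ s * ((block_start (psi n.+1))%:R ^+ 2) `^ s / (block_start (psi n.+1))%:R)
  else distortion n / digit_pressure.
Proof. by []. Qed.

Hypothesis psi_gt0 : forall n : nat, (0 < n)%N -> 0 < psi n.
Hypothesis psi_cvg : psi n @[n --> \oo] --> +oo.
Hypothesis s_gt0 : 0 < s.
Hypothesis s_le1 : s <= 1.
Hypothesis alpha_ge0 : 0 <= alpha.
Hypothesis psi_often : forall N, exists2 n, (N <= n)%N & psi n <= alpha * n%:R.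
Hypothesis pressure_gt : expR (alpha * s) < digit_pressure.

Let pressure_gt1 : 1 < digit_pressure.
Proof. by apply: le_lt_trans pressure_gt; rewrite -expR0 ler_expR mulr_ge0 ?(ltW s_gt0). Qed.

Let pressure_gt0 : 0 < digit_pressure. Proof. exact: lt_trans pressure_gt1. Qed.

Let N n := block_start (psi n.+1).

Let N_ge2 n : (1 < N n)%N. Proof. by apply: block_start_ge2; exact: psi_gt0. Qed.

Let N_gt0 n : 0 < (N n)%:R :> R. Proof. by rewrite ltr0n ltnW. Qed.

Let distortion_gt0 n : 0 < distortion n.
Proof.
elim: n => [|n IH]; first by rewrite /distortion.
rewrite distortionS; case: ifP => _; last exact: divr_gt0.
by rewrite mulr_gt0// divr_gt0// mulr_gt0// powR_gt0 ?exprn_gt0.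
Qed.

(** A block starts only when the distortion times N^s is at most 1; its factor 4^s N^(2 s - 1) then
    leaves at most 4^s N^(s - 1) <= 4^s, as s <= 1. All other steps divide by a number above 1. *)
Let distortion_le n : distortion n <= 4 `^ s.
Proof.
have s4 : 1 <= 4 `^ s :> R.
  by rewrite -[leLHS](powRr0 (4 : R)) ler_powR ?ler1n// ltW.
elim: n => [|n IH]; first by [].
rewrite distortionS; case: ifP => [/andP[_ h]|_]; last first.
  by rewrite ler_pdivrMr// (le_trans IH)// ler_peMr ?powR_ge0// ltW.
have Ns : (N n)%:R `^ s / (N n)%:R <= 1 :> R.
  by rewrite ler_pdivrMr// mul1r ler1_powR// ler1n ltnW.
rewrite -/(N n) powRXn// (_ : _ * _ =
  4 `^ s * ((distortion n * (N n)%:R `^ s) * ((N n)%:R `^ s / (N n)%:R))); last by ring.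
rewrite ger_pMr ?powR_gt0// mulr_ile1// ?mulr_ge0 ?powR_ge0 ?invr_ge0//.
exact: ltW.
Qed.

Let block_often N0 : exists2 n, (N0 <= n)%N & block_at (distortion n) n.
Proof.
apply: contrapT => H.
have E k : distortion (N0 + k) = distortion N0 / digit_pressure ^+ k.
  elim: k => [|k IH]; first by rewrite addn0 expr0 divr1.
  rewrite addnS distortionS IH ifF; first by rewrite exprSr invfM mulrA.
  by rewrite -IH; apply/negbTE/negP => h; apply: H; exists (N0 + k)%N => //; rewrite leq_addr.
pose q := digit_pressure / expR (alpha * s).
have q1 : 1 < q by rewrite ltr_pdivlMr ?expR_gt0// mul1r.
(* The factor 2^s comes from N <= 2 e^psi. Beyond [k0] the power of [q] outweighs the distortion at
   [N0], so any later position with small [psi] passes both tests of [block_at]. *)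
have [k0 Hk0] := expr_ge_near (distortion N0 * 2 `^ s * expR (alpha * s * N0.+1%:R) + 1) q1.
have [[//|n] Nn Hn] := psi_often (N0 + k0).+1.
rewrite ltnS in Nn; have N0n : (N0 <= n)%N by apply: leq_trans Nn; rewrite leq_addr.
apply: H; exists n => //; rewrite /block_at Hn/=.
have /andP[_ b2] := block_start_itv (psi_gt0 (ltn0Sn n)).
rewrite -(subnKC N0n) E subnKC//; set k := (n - N0)%N.
have kk : (k0 <= k)%N by rewrite leq_subRL.
apply: (@le_trans _ _ (distortion N0 / digit_pressure ^+ k *
   (2 `^ s * expR (alpha * s * n.+1%:R)))).
  rewrite ler_pM2l; last by rewrite divr_gt0 ?exprn_gt0.
  apply: (@le_trans _ _ ((2 * expR (psi n.+1)) `^ s)).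
    by apply: le_powR => //; exact: ltW.
  rewrite powRM ?expR_ge0// ler_pM2l ?powR_gt0// -expRM ler_expR.
  by rewrite [leRHS]mulrAC; apply: ler_wpM2r => //; exact: ltW.
have nE : n.+1%:R = N0.+1%:R + k%:R :> R.
  by rewrite -natrD addSn /k subnKC.
rewrite nE mulrDr expRD expRM_natr.
have := Hk0 k kk; rewrite /q expr_div_n ler_pdivlMr ?exprn_gt0 ?expR_gt0// => h.
rewrite mulrAC ler_pdivrMr ?exprn_gt0// mul1r; apply: le_trans h.
by rewrite !mulrA !expRM_natr ler_pM2r ?exprn_gt0 ?expR_gt0// lerDl.
Qed.

Let lo n := if block_at (distortion n) n then N n else 2%N.
Let mm n := if block_at (distortion n) n then N n else M.
Let ww n i : R := if block_at (distortion n) n then (N n)%:R^-1 else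
  ((i.+2%:R * (i.+2%:R - 1))^-1) `^ s / digit_pressure.

Lemma hausdorff_dim_E_sup_ge_sparse : (s%:E <= hausdorff_dim (E_sup psi))%E.
Proof.
have cyl i : 0 < i.+2%:R * (i.+2%:R - 1) :> R.
  by rewrite mulr_gt0// subr_gt0 ltr1n.
(* The 6 serves the uniform blocks. Off the blocks a partial sum of weights is at most 1, and each
   weight is at least the inverse of the second term. *)
pose K := 6 + digit_pressure * (M.+2%:R ^+ 2) `^ s.
(* First term: off the blocks the distortion is at most 4^s and digits stay below M + 2. Second
   term: at a block the distortion times N^s is at most 1 and digits stay below 2 N. *)
pose C := 4 `^ s * M.+2%:R `^ s + 2 `^ s : R.
have K6 : 6 <= K by rewrite lerDl mulr_ge0 ?powR_ge0 ?(ltW pressure_gt0).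
apply: (@hausdorff_dim_ge_digits R lo mm ww distortion s K C) => //.
- exact: ltW.
- exact: lt_le_trans K6.
- by rewrite addr_gt0 ?mulr_gt0 ?powR_gt0.
- by move=> n; rewrite /lo; case: ifP.
- move=> n i; rewrite /ww; case: ifP => _ _; first by rewrite invr_gt0.
  by rewrite divr_gt0// powR_gt0// invr_gt0.
- move=> n; rewrite /mm /ww; case: ifP => _.
    by rewrite sumr_const card_ord -[_ *+ _]mulr_natr mulVf// gt_eqF.
  by rewrite -mulr_suml divff// gt_eqF.
- move=> n i; rewrite /lo /mm /ww distortionS; case: ifP => _ iN.
    rewrite ler_pM2l//; apply: block_weight_le; [exact: ltW| |by rewrite ltn_add2l].
    by rewrite addn_gt0 ltnW.
  rewrite ler_pM2l// add2n powRV ?(ltW (cyl i))// mulrAC mulVf ?mul1r//.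
- move=> n; rewrite /lo /mm /C; case: ifPn => [/andP[_ h]|_].
    apply: (@le_trans _ _ (2 `^ s)); last by rewrite lerDr mulr_ge0 ?powR_ge0.
    rewrite (_ : (N n + N n)%:R = 2 * (N n)%:R); last by rewrite natrD mulr2n mulrDl mul1r.
    by rewrite powRM// mulrCA ger_pMr ?powR_gt0.
  by rewrite add2n ler_wpDr ?powR_ge0// ler_wpM2r ?powR_ge0.
- move=> n i i' ii; rewrite /lo /mm /ww; case: ifPn => _ iN.
    by apply: uniform_block; rewrite ?(ltW s_gt0).
  left; apply: (@le_trans _ _ 1).
    rewrite [leRHS](_ : 1 = \sum_(0 <= j < M)
        (j.+2%:R * (j.+2%:R - 1))^-1 `^ s / digit_pressure :> R); last first.
      by rewrite big_mkord -mulr_suml divff// gt_eqF.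
    rewrite [leRHS](big_cat_nat (n := i))//=; last by rewrite ltnW// (ltn_trans ii).
    rewrite [X in _ + X](big_cat_nat (n := i'.+1))//=; last by rewrite ltnW// ltnW.
    rewrite addrCA lerDl addr_ge0// sumr_ge0// => j _;
      by rewrite divr_ge0 ?powR_ge0// ltW.
  rewrite powRV ?(ltW (cyl i))// -invfM ler_pdivlMr ?mulr_gt0 ?powR_gt0// mul1r mulrC.
  apply: (@le_trans _ _ (digit_pressure * (M.+2%:R ^+ 2) `^ s)); last by rewrite /K lerDr.
  rewrite ler_pM2l//; apply: le_powR; [exact: ltW|exact: ltW|].
  have : i.+2%:R <= M.+2%:R :> R by rewrite ler_nat !ltnS ltnW// (ltn_trans ii).
  have : 1 <= i.+2%:R :> R by rewrite ler1n.
  by nra.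
move=> x x01 Hx; apply: (E_supP (B := ln 4 + ln M.+2%:R)) => //.
  move=> n; have := Hx n; rewrite /lo /mm; case: ifP => _ h.
    have /andP[_ h2] := ln_block (psi_gt0 (ltn0Sn n)) h.
    by apply: (le_trans h2); rewrite addrA lerDl ln_ge0// ler1n.
  have [_ d1] := digit1E (iter_luroth_map_itv n x01).
  have : ln (digit (iter n luroth_map x))%:R <= ln M.+2%:R :> R.
    rewrite ler_ln ?posrE ?ltr0n// ?ler_nat; last exact: ltnW.
    by case/andP: h => _ /ltnW.
  have : 0 <= ln (4 : R) by rewrite ln_ge0// ler1n.
  have := psi_gt0 (ltn0Sn n); lra.
move=> N0; have [n Nn bn] := block_often N0.
exists n => //; have := Hx n; rewrite /lo /mm bn => h.
by have /andP[] := ln_block (psi_gt0 (ltn0Sn n)) h.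
Qed.

End SparseBlocks.

(** * Pressure thresholds *)

Section Pressure.
Context {R : realType}.
Implicit Types (s t alpha : R) (E : set R).

Let cylinder_gt0 k : 0 < k.+2%:R * (k.+2%:R - 1) :> R.
Proof. by rewrite mulr_gt0// subr_gt0 ltr1n. Qed.

(** Each one-digit cylinder has length at most 1/2. *)
Lemma digit_pressureD s t M : 0 <= t ->
  digit_pressure (s + t) M <= 2^-1 `^ t * digit_pressure s M.
Proof.
move=> t0; rewrite /digit_pressure mulr_sumr; apply: ler_sum => k _.
rewrite powRD; last by apply/implyP => _; rewrite gt_eqF ?invr_gt0.
rewrite mulrC ler_wpM2r ?powR_ge0//; apply: le_powR; rewrite ?invr_ge0 ?(ltW (cylinder_gt0 k))//.
rewrite lef_pV2 ?posrE//; have : 2 <= k.+2%:R :> R by rewrite ler_nat.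
by nra.
Qed.

(** Telescoping of 1/((k + 2) (k + 1)) = 1/(k + 1) - 1/(k + 2). *)
Lemma digit_pressure1 M : digit_pressure 1 M = 1 - M.+1%:R^-1 :> R.
Proof.
rewrite /digit_pressure -(big_mkord xpredT
  (fun k => ((k.+2%:R * (k.+2%:R - 1))^-1 : R) `^ 1)).
rewrite (telescope_sumr_eq (fun k => - (k.+1%:R : R)^-1))// => [|k _].
  by rewrite invr1 opprK addrC.
rewrite powRr1 ?invr_ge0 ?(ltW (cylinder_gt0 k))// -[k.+2%:R]natr1 addrK.
have : 0 < k.+1%:R :> R by rewrite ltr0n.
by move: k.+1%:R => z z0; field; rewrite !gt_eqF//; lra.
Qed.

Lemma digit_pressure_le1 s M : 1 <= s -> digit_pressure s M <= 2^-1 `^ (s - 1).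
Proof.
move=> s1; rewrite -{1}(subrKC 1 s); apply: le_trans (digit_pressureD _ _ _) _.
  by rewrite subr_ge0.
by rewrite ler_piMr ?powR_ge0// digit_pressure1 lerBlDr lerDl invr_ge0.
Qed.

(** At exponent 1 the sum is 1 - 1/(M + 1); lowering the exponent to s gains at least the factor
    2^(1 - s), which brings it above 1 for large M. *)
Lemma digit_pressure_gt1 s : s < 1 -> exists M, 1 < digit_pressure s M.
Proof.
move=> s1; have t0 : 0 < 1 - s by rewrite subr_gt0.
have h0 : 0 < 1 - 2^-1 `^ (1 - s) :> R by rewrite subr_gt0 half_powR_lt1.
have [M HM] := natr_ge_near ((1 - 2^-1 `^ (1 - s)) ^-1 : R).
exists M; have := @digit_pressureD s (1 - s) M (ltW t0).
rewrite subrKC digit_pressure1 => h.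
have iM : M.+1%:R^-1 < 1 - 2^-1 `^ (1 - s) :> R.
  rewrite -[ltRHS]invrK ltf_pV2 ?posrE ?invr_gt0//.
  by apply: le_lt_trans (HM M (leqnn _)) _; rewrite ltr_nat.
have p0 : 0 < 2^-1 `^ (1 - s) :> R by rewrite powR_gt0 ?invr_gt0.
by rewrite -(ltr_pM2l p0) mulr1; apply: lt_le_trans h; rewrite ltrBrDr addrC -ltrBrDr.
Qed.

(* Telescoping [k ^ (1 - t) / (t - 1)], by [ln (1 + x) <= x]. *)
Lemma p_series_le t M : 1 < t -> \sum_(k < M) (k.+2%:R : R)^-1 `^ t <= (t - 1)^-1.
Proof.
move=> t1; pose u := t - 1; have u0 : 0 < u by rewrite subr_gt0.
pose f k : R := - (u^-1 * k.+1%:R^-1 `^ u).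
apply: (@le_trans _ _ (\sum_(0 <= k < M) (f k.+1 - f k))); last first.
  rewrite telescope_sumr// /f opprK invr1 powR1 mulr1 -/u.
  by rewrite gerDr oppr_le0 mulr_ge0 ?powR_ge0// invr_ge0 ltW.
rewrite big_mkord; apply: ler_sum => k _.
rewrite /f opprK addrC -mulrBr -/u -(ler_pM2l u0) mulrA divff ?gt_eqF// mul1r.
have k2 : 0 < k.+2%:R^-1 :> R by rewrite invr_gt0.
have -> : t = u + 1 by rewrite /u subrK.
rewrite powRD; last by apply/implyP => _; rewrite gt_eqF.
rewrite powRr1 ?(ltW k2)//.
have -> : k.+1%:R^-1 = k.+2%:R^-1 * (k.+2%:R / k.+1%:R) :> R.
  by rewrite mulKf.
rewrite powRM ?(ltW k2)//.
have q : 1 + u * k.+2%:R^-1 <= (k.+2%:R / k.+1%:R) `^ u :> R.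
  have q0 : 0 < k.+2%:R / k.+1%:R :> R by rewrite divr_gt0.
  rewrite /powR gt_eqF//; apply: le_trans (expR_ge1Dx _).
  rewrite lerD2l ler_pM2l// -[_ / _]invrK lnV ?posrE ?invr_gt0// lerNr.
  have -> : (k.+2%:R / k.+1%:R)^-1 = 1 + - k.+2%:R^-1 :> R.
    rewrite -[k.+2%:R]natr1; have : 0 < k.+1%:R :> R by rewrite ltr0n.
    by move: k.+1%:R => z z0; field; rewrite !gt_eqF//; lra.
  apply: le_ln1Dx; rewrite ltrN2 invf_lt1// ltr1n//.
have A0 := powR_gt0 u k2; have := ler_wpM2l (ltW A0) q.
by rewrite mulrDr mulr1 mulrCA -lerBrDl.
Qed.

Lemma hausdorff_dim_le_digits (E : set R) s q L K :
  0 < s -> 0 <= q -> 0 <= L ->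
  (forall M, \sum_(k < M)
     ((k.+2%:R * (k.+2%:R - 1))^-1 * (k.+2%:R `^ q)^-1) `^ s <= K) ->
  expR (- L) `^ s * K < 1 ->
  (forall x, E x -> 0 < x <= 1 /\ forall N, exists2 n, (N <= n)%N &
    (\prod_(i < n) (digit (iter i luroth_map x))%:R) `^ q * expR L ^+ n <=
      (digit (iter n luroth_map x))%:R) ->
  (hausdorff_dim E <= s%:E)%E.
Proof.
move=> s0 q0 L0 aK LK HE; apply: le_trans (hausdorff_dim_subset HE) _.
by apply: hausdorff_dim_le; [exact: ltW|exact: hausdorff_measure0_digits LK].
Qed.

Lemma hausdorff_dim_le_linear (E : set R) s L rho :
  0 < s -> 0 <= L -> rho < 1 -> (forall M, digit_pressure s M * expR (- (L * s)) <= rho) ->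
  (forall x, E x -> 0 < x <= 1 /\ forall N, exists2 n, (N <= n)%N &
    L * n.+1%:R <= ln (digit (iter n luroth_map x))%:R) ->
  (hausdorff_dim E <= s%:E)%E.
Proof.
move=> s0 L0 r1 Hr HE.
apply: (@hausdorff_dim_le_digits E s 0 L (rho * expR (L * s))) => //.
- move=> M; under eq_bigr do rewrite powRr0 invr1 mulr1.
  by rewrite -ler_pdivrMr ?expR_gt0// -expRN; exact: Hr.
- by rewrite -expRM mulNr mulrCA -expRD addNr expR0 mulr1.
move=> x /HE[x01 H]; split => // N; have [n Nn Hn] := H N; exists n => //.
have d0 : 0 < (digit (iter n luroth_map x))%:R :> R.
  by rewrite ltr0n ltnW// (digit1E (iter_luroth_map_itv n x01)).2.
rewrite powRr0 mul1r -expRM_natr -[leRHS]lnK ?posrE// ler_expR.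
by apply: le_trans Hn; rewrite ler_wpM2l// ler_nat.
Qed.

Lemma E_sup_often (psi : nat -> R) x c : (forall n : nat, (0 < n)%N -> 0 < psi n) ->
  c < 1 -> E_sup psi x -> 0 < x <= 1 /\ forall N, exists2 n, (N <= n)%N &
    c * psi n.+1 <= ln (digit (iter n luroth_map x))%:R.
Proof.
move=> psi0 c1 [x01 Hx]; rewrite /= in_itv/= in x01; split => // N.
have cl : (c%:E < limn_esup (fun n => (ln (luroth_digit n x)%:~R / psi n)%:E))%E.
  by rewrite Hx lte_fin.
have [[//|n] Nn] := lt_limn_esup_exists cl N.+1.
rewrite luroth_digitE// lte_fin ltr_pdivlMr ?psi0// => Hn.
by exists n => //; exact: ltW.
Qed.

Lemma ereal_between (x y : \bar R) : (0 <= x)%E -> (x < y)%E ->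
  exists r : R, (x < r%:E < y)%E.
Proof.
case: x => [x| |]//; case: y => [y| |]// _; last first.
  by move=> _; exists (x + 1); rewrite lte_fin ltry ltrDl ltr01.
by rewrite lte_fin => xy; exists ((x + y) / 2); rewrite !lte_fin; lra.
Qed.

(** With [rho] independent of [M], the hypothesis puts the infinite digit sum below e^(alpha s)
    without forming a sum that may diverge. *)
Definition pressure_upper alpha E := forall s rho, 0 < s -> rho < 1 ->
  (forall M, digit_pressure s M * expR (- (alpha * s)) <= rho) -> (hausdorff_dim E <= s%:E)%E.

Definition pressure_lower alpha E := forall s M, 0 < s -> s <= 1 ->
  expR (alpha * s) < digit_pressure s M -> (s%:E <= hausdorff_dim E)%E.

(** Otherwise take t < s strictly between the two dimensions. Failure of the lower bound at t gives
    pressure at most e^(alpha t) for every M; passing to s gains the factor 2^(t - s), uniformly in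
    M, so the upper bound applies at s, a contradiction. *)
Lemma hausdorff_dim_le_pressure alpha E F : 0 <= alpha ->
  pressure_lower alpha E -> pressure_upper alpha F -> (hausdorff_dim F <= hausdorff_dim E)%E.
Proof.
move=> a0 lE uF; rewrite leNgt; apply/negP => EF.
have [t /andP[Et tF]] := ereal_between (hausdorff_dim_ge0 E) EF.
have t0 : 0 < t by rewrite -lte_fin; apply: le_lt_trans Et; exact: hausdorff_dim_ge0.
have tE0 : (0 <= t%:E)%E by rewrite lee_fin ltW.
have [s /andP[ts sF]] := ereal_between tE0 tF.
rewrite lte_fin in ts.
have pt M : digit_pressure t M <= expR (alpha * t).
  have [t1|t1] := leP t 1.
    by rewrite leNgt; apply/negP => /(lE t M t0 t1); rewrite leNgt Et.
  apply: (le_trans (digit_pressure_le1 M (ltW t1))); apply: (@le_trans _ _ 1).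
    by rewrite ltW// half_powR_lt1// subr_gt0.
  by rewrite -expR0 ler_expR mulr_ge0// ltW.
have : (hausdorff_dim F <= s%:E)%E.
  apply: (uF s (2^-1 `^ (s - t))); [exact: lt_trans ts|by apply: half_powR_lt1; rewrite subr_gt0|].
  move=> M; rewrite -ler_pdivlMr ?expR_gt0// -expRN opprK.
  have st : 0 <= s - t by rewrite subr_ge0 ltW.
  have := digit_pressureD t M st; rewrite subrKC => /le_trans; apply.
  rewrite ler_wpM2l ?powR_ge0//; apply: (le_trans (pt M)).
  by rewrite ler_expR ler_wpM2l// ltW.
by rewrite leNgt sF.
Qed.

Lemma E_sup_pressure_lower (psi : nat -> R) alpha : 0 <= alpha ->
  (forall n : nat, (0 < n)%N -> 0 < psi n) -> psi n @[n --> \oo] --> +oo ->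
  (forall e, 0 < e -> forall N, exists2 n, (N <= n)%N & psi n <= (alpha + e) * n%:R) ->
  pressure_lower alpha (E_sup psi).
Proof.
move=> a0 psi0 psioo often s M s0 s1 h.
have p0 : 0 < digit_pressure s M by apply: lt_trans h; exact: expR_gt0.
have h' : alpha * s < ln (digit_pressure s M) by rewrite -[ltLHS]expRK ltr_ln ?posrE ?expR_gt0.
(* Puts (alpha + e) s midway between alpha s and the logarithm of the pressure. *)
pose e := (ln (digit_pressure s M) - alpha * s) / 2 / s.
have e0 : 0 < e by rewrite !divr_gt0// subr_gt0.
apply: (@hausdorff_dim_E_sup_ge_sparse R psi s (alpha + e) M) => //.
- by rewrite addr_ge0// ltW.
- exact: often.
- rewrite -[ltRHS]lnK ?posrE// ltr_expR mulrDl /e divfK ?gt_eqF//; lra.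
Qed.

End Pressure.

(** * Upper bound for superlinear growth *)

Section FastUpper.
Context {R : realType}.
Implicit Types (psi : nat -> R) (x : R).

Let logdigit x n : R := ln (digit (iter n luroth_map x))%:R.

Let logdigit_ge0 x n : 0 < x <= 1 -> 0 <= logdigit x n.
Proof.
move=> x01; rewrite ln_ge0// ler1n ltnW//.
exact: (digit1E (iter_luroth_map_itv n x01)).2.
Qed.

Lemma geometric_ge_linear (b c : R) : 1 < b -> 0 <= c ->
  exists N, forall n, (N <= n)%N -> c * n%:R <= b ^+ n.
Proof.
move=> b1 c0; have b0 : 0 < b := lt_trans ltr01 b1.
have l0 : 0 < ln b by rewrite ln_gt0.
have [N HN] := natr_ge_near (2 * c / (ln b) ^+ 2).
exists N => n /HN; rewrite ler_pdivrMr ?exprn_gt0// => h.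
rewrite -[b in leRHS]lnK ?posrE// -expRM_natr.
have x0 : 0 <= ln b * n%:R by rewrite mulr_ge0// ltW.
apply: le_trans (expR_ge1Dxn 1 x0).
have := ler_wpM2l (ler0n R n) h.
rewrite exprMn (_ : 2`! = 2%N)//; move: (n%:R : R) => m; nra.
Qed.

(* The first [n] at which [l n / b ^ n] exceeds all its values before [N]. *)
Lemma record_often (l : nat -> R) (b : R) : 1 < b -> (forall n, 0 <= l n) ->
  (forall M, exists n, M * b ^+ n < l n) ->
  forall N, exists2 n, (N <= n)%N &
    b ^+ n <= l n /\ (b - 1) * \sum_(j < n) l j <= l n.
Proof.
move=> b1 l0 unb N; have b0 : 0 < b := lt_trans ltr01 b1.
have bn n : 0 < b ^+ n by rewrite exprn_gt0.
(* M b^n cannot be exceeded before N, and M >= 1 turns the excess into b^n <= l n. *)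
pose M := 1 + \sum_(j < N) l j / b ^+ j.
have M1 : 1 <= M by rewrite lerDl sumr_ge0// => j _; rewrite divr_ge0// ltW.
have Mj j : (j < N)%N -> l j / b ^+ j <= M.
  move=> jN; rewrite /M (bigD1 (Ordinal jN))//= addrCA lerDl addr_ge0// sumr_ge0// => i _.
  by rewrite divr_ge0// ltW.
have ex := unb M; case: (ex_minnP ex) => n nP nmin.
have Nn : (N <= n)%N.
  rewrite leqNgt; apply/negP => /Mj; rewrite ler_pdivrMr// leNgt.
  by rewrite nP.
exists n => //; split; first by apply: le_trans (ltW nP); rewrite ler_peMl// ltW.
apply: (@le_trans _ _ ((b - 1) * \sum_(j < n) (M * b ^+ j))).
  rewrite ler_pM2l ?subr_gt0//; apply: ler_sum => j _.
  by rewrite leNgt; apply/negP => /nmin; rewrite leqNgt ltn_ord.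
rewrite -mulr_sumr mulrCA -subrX1; apply: le_trans (ltW nP).
by rewrite ler_pM2l ?(lt_le_trans ltr01 M1)// lerBlDr lerDl.
Qed.

(** The digit sum is dominated by 2^s times the series of d^(- s (2 + q)), which converges since s
    (2 + q) > 1. *)
Lemma hausdorff_dim_le_logdigits (E : set R) (s q : R) : 0 < s -> 0 <= q -> 1 < s * (2 + q) ->
  (forall L x, 0 <= L -> E x -> 0 < x <= 1 /\ forall N, exists2 n, (N <= n)%N &
    q * \sum_(j < n) ln (digit (iter j luroth_map x))%:R + L * n%:R <=
      ln (digit (iter n luroth_map x))%:R) ->
  (hausdorff_dim E <= s%:E)%E.
Proof.
move=> s0 q0 sq HE.
pose K : R := 2 `^ s * (s * (2 + q) - 1)^-1.
have K0 : 0 < K by rewrite mulr_gt0 ?powR_gt0// invr_gt0 subr_gt0.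
have L0 : 0 <= K / s by rewrite divr_ge0// ltW.
(* With L = K / s the ratio becomes K e^(- K), below 1 because e^K > K. *)
apply: (@hausdorff_dim_le_digits R E s q (K / s) K) => //.
- move=> M; apply: le_trans (ler_wpM2l (powR_ge0 _ _) (p_series_le M sq)).
  rewrite mulr_sumr; apply: ler_sum => k _.
  have z0 : 0 < k.+2%:R^-1 :> R by rewrite invr_gt0.
  have k1 : 0 < k.+2%:R * (k.+2%:R - 1) :> R by rewrite mulr_gt0// subr_gt0 ltr1n.
  rewrite [s * _]mulrC powRrM -powRM ?powR_ge0//.
  apply: le_powR; [exact: ltW|by rewrite mulr_ge0 ?invr_ge0 ?powR_ge0 ?(ltW k1)|].
  rewrite powRD; last by apply/implyP => _; rewrite gt_eqF.
  rewrite (powR_mulrn 2) ?(ltW z0)// powRV// mulrA ler_wpM2r ?invr_ge0 ?powR_ge0//.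
  have k2 : 2 <= k.+2%:R :> R by rewrite ler_nat.
  rewrite exprVn -[2 in leRHS]invrK -invfM lef_pV2 ?posrE ?mulr_gt0 ?exprn_gt0//.
  by nra.
- rewrite -expRM mulNr divfK ?gt_eqF// expRN mulrC ltr_pdivrMr ?expR_gt0// mul1r.
  by apply: lt_le_trans (expR_ge1Dx K); rewrite ltrDr.
move=> x Ex; have [x01 H] := HE _ _ L0 Ex; split => // N.
have [n Nn Hn] := H N; exists n => //.
have d0 j : 0 < (digit (iter j luroth_map x))%:R :> R.
  by rewrite ltr0n ltnW// (digit1E (iter_luroth_map_itv j x01)).2.
rewrite (eq_bigr (fun j : 'I_n => expR (ln (digit (iter j luroth_map x))%:R))); last first.
  by move=> j _; rewrite lnK ?posrE.
rewrite -expR_sum -expRM -expRM_natr -expRD [_ * q]mulrC -[leRHS]lnK ?posrE// ler_expR.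
by [].
Qed.

(** For b > 1 a fraction eta of a record digit's logarithm pays for the linear term L n, and the
    rest gives q = (1 - eta) (b - 1). For b = 1 superlinearity suffices, with q = 0. *)
Lemma hausdorff_dim_E_sup_le_fast psi (b s : R) :
  (forall n : nat, (0 < n)%N -> 0 < psi n) ->
  (forall L, exists N, forall n, (N <= n)%N -> L * n%:R <= psi n) ->
  1 <= b -> (b = 1 \/ exists B, b < B /\ exists N, forall n, (N <= n)%N -> B ^+ n <= psi n) ->
  0 < s -> 1 < s * (1 + b) -> (hausdorff_dim (E_sup psi) <= s%:E)%E.
Proof.
move=> psi0 lin b1 cse s0 sb.
have half1 : 2^-1 < 1 :> R by rewrite invf_lt1 ?ltr1n.
have [b1'|b1'] := eqVneq b 1.
  apply: (@hausdorff_dim_le_logdigits _ s 0) => //.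
    by rewrite addr0 (_ : 2 = 1 + b)// b1'.
  move=> L x L0 /(E_sup_often psi0 half1)[x01 H]; split => // N.
  have [N2 HN2] := lin (2 * L).
  have [n] := H (maxn N N2); rewrite geq_max => /andP[Nn N2n] Hn.
  exists n => //; rewrite mul0r add0r; apply: le_trans Hn.
  have := HN2 n.+1 (leqW N2n); rewrite -[n.+1%:R]natr1; lra.
case: cse => [/eqP|[B [bB [N1 HN1]]]]; first by rewrite (negbTE b1').
have bgt1 : 1 < b by rewrite lt_neqAle eq_sym b1'.
have b0 : 0 < b := lt_trans ltr01 bgt1.
pose kappa := s * (1 + b) - 1.
have kappa0 : 0 < kappa by rewrite subr_gt0.
have sb0 : 0 < s * (b - 1) by rewrite mulr_gt0// subr_gt0.
(* Small enough that eta s (b - 1) < kappa, which keeps s (2 + q) above 1. *)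
pose eta := kappa / (s * (b - 1) + kappa).
have den0 : 0 < s * (b - 1) + kappa by exact: addr_gt0.
have eta0 : 0 < eta by exact: divr_gt0.
have eta1 : eta < 1 by rewrite /eta ltr_pdivrMr// mul1r ltrDr.
have etaE : eta * (s * (b - 1)) < kappa.
  by rewrite /eta mulrAC ltr_pdivrMr// ltr_pM2l// ltrDl.
apply: (@hausdorff_dim_le_logdigits _ s ((1 - eta) * (b - 1))) => //.
- by rewrite mulr_ge0// subr_ge0 ltW.
- by move: etaE; rewrite /kappa; lra.
move=> L x L0 /(E_sup_often psi0 half1)[x01 H]; split => // N.
have [N2 HN2] := geometric_ge_linear bgt1 (divr_ge0 L0 (ltW eta0)).
(* Infinitely often ln d_(n+1) >= psi (n + 1) / 2 >= B^(n+1) / 2, and (B/b)^n outgrows any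
   constant. *)
have unb M : exists n, M * b ^+ n < logdigit x n.
  have q1 : 1 < B / b by rewrite ltr_pdivlMr// mul1r.
  have [N3 HN3] := expr_ge_near (2 * `|M| + 1) q1.
  have [n] := H (maxn N1 N3); rewrite geq_max => /andP[N1n N3n] Hn.
  exists n; apply: lt_le_trans Hn.
  have := HN3 n N3n; rewrite expr_div_n ler_pdivlMr ?exprn_gt0// => h1.
  have h2 := HN1 n.+1 (leqW N1n).
  have h3 : B ^+ n <= B ^+ n.+1.
    by rewrite exprS ler_peMl ?exprn_ge0 ?(ltW (lt_trans bgt1 bB)) ?(ltW (lt_trans b0 bB)).
  have h4 : M * b ^+ n <= `|M| * b ^+ n by rewrite ler_pM2r ?exprn_gt0// ler_norm.
  have h5 : 0 < b ^+ n by rewrite exprn_gt0.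
  by move: h1 h2 h3 h4 h5; rewrite mulrDl mul1r -mulrA; lra.
have [n] := record_often bgt1 (fun n => logdigit_ge0 n x01) unb (maxn N N2).
rewrite geq_max => /andP[Nn N2n] [h1 h2]; exists n => //.
have h3 := HN2 n N2n; rewrite mulrAC ler_pdivrMr// in h3.
rewrite -/(logdigit x n) -mulrA.
have eta1' : 0 <= 1 - eta by rewrite subr_ge0 ltW.
have h4 := ler_wpM2l eta1' h2.
have h5 := ler_wpM2r (ltW eta0) h1.
by lra.
Qed.

End FastUpper.

Section ExtendedBounds.
Context {R : realType}.
Implicit Types (x : \bar R) (r : R).

Lemma ereal_le_of_gt x r : (forall s : R, r < s -> (x <= s%:E)%E) -> (x <= r%:E)%E.
Proof. by move=> H; apply/lee_addgt0Pr => e e0; apply: H; rewrite ltrDl. Qed.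

Lemma ereal_ge_of_lt x r : (0 <= x)%E -> (forall s : R, 0 < s -> s < r -> (s%:E <= x)%E) ->
  (r%:E <= x)%E.
Proof.
move=> x0 H; rewrite leNgt; apply/negP => xr.
have [s /andP[xs sr]] := ereal_between x0 xr.
rewrite lte_fin in sr; have s0 : 0 < s by rewrite -lte_fin; apply: le_lt_trans xs.
by have := H s s0 sr; rewrite leNgt xs.
Qed.

End ExtendedBounds.

Lemma infinite_nat_unbounded (A : set nat) :
  (forall N, exists2 n, (N <= n)%N & A n) -> infinite_set A.
Proof.
move=> H /finite_seqP[l lA]; have [n + An] := H (\max_(i <- l) i).+1.
have : n \in l by move: An; rewrite lA.
move=> nl; have := @leq_bigmax_seq _ l xpredT id n nl isT.
by rewrite leqNgt => /negP.
Qed.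

(** * The three growth regimes *)

Section Cases.
Context {R : realType}.
Variable psi : nat -> R.
Hypothesis psi_gt0 : forall n : nat, (0 < n)%N -> 0 < psi n.
Hypothesis psi_cvg : psi n @[n --> \oo] --> +oo.

Lemma hausdorff_dim_E_sup_slow : psi n / n%:R @[n --> \oo] --> 0 ->
  hausdorff_dim (E_sup psi) = 1%E.
Proof.
move=> psin; apply/eqP; rewrite eq_le; apply/andP; split.
  apply: ereal_le_of_gt => s s1; have s0 : 0 < s := lt_trans ltr01 s1.
  (* With L = 0 the digit condition is trivial, and above exponent 1 the pressure is at most 2^(1 -
     s) < 1. *)
  apply: (@hausdorff_dim_le_linear R _ s 0 (2^-1 `^ (s - 1))) => //.
  - by apply: half_powR_lt1; rewrite subr_gt0.
  - by move=> M; rewrite mul0r oppr0 expR0 mulr1 digit_pressure_le1// ltW.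
  move=> x /(E_sup_often psi_gt0 ltr01)[x01 H]; split => // N; have [n Nn Hn] := H N.
  by exists n => //; move: Hn; rewrite !mul0r.
apply: ereal_ge_of_lt => [|s s0 s1]; first exact: hausdorff_dim_ge0.
have [M HM] := digit_pressure_gt1 s1.
have lE : pressure_lower 0 (E_sup psi).
  apply: E_sup_pressure_lower => // e e0 N.
  have [N1 HN1] := cvgn0_near psin e0.
  exists (maxn N N1).+1; first exact: leqW (leq_maxl _ _).
  have := HN1 (maxn N N1).+1 (leqW (leq_maxr _ _)).
  by rewrite ger0_norm ?divr_ge0 ?(ltW (psi_gt0 _))// ltr_pdivrMr// add0r => /ltW.
by apply: (lE s M s0 (ltW s1)); rewrite mul0r expR0.
Qed.

(** Since rho < 1, alpha can be lowered by a small e. As [psi n] is eventually above (alpha - e/2)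
    n, points of the set have ln d_n >= (alpha - e) n infinitely often. *)
Lemma E_sup_pressure_upper alpha : 0 < alpha ->
  (forall a, a < alpha -> exists N, forall n, (N <= n)%N -> a * n%:R <= psi n) ->
  pressure_upper alpha (E_sup psi).
Proof.
move=> a0 Ha s rho s0 r1 Hr.
have [e e0 [ea re]] : exists2 e, 0 < e & e <= alpha /\ rho * expR (e * s) < 1.
  have [r0|r0] := leP rho 0.
    exists alpha => //; split => //; apply: le_lt_trans ltr01.
    by rewrite mulr_le0_ge0// expR_ge0.
  pose e := Num.min alpha (- ln rho / 2 / s).
  have lr : 0 < - ln rho by rewrite oppr_gt0 ln_lt0// r0.
  exists e; first by rewrite lt_min a0/= !divr_gt0.
  split; first by rewrite ge_min lexx.
  rewrite -[rho in ltLHS]lnK ?posrE// -expRD -[ltRHS]expR0 ltr_expR.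
  have : e * s <= - ln rho / 2 by rewrite -ler_pdivlMr// ge_min lexx orbT.
  by lra.
apply: (@hausdorff_dim_le_linear R _ s (alpha - e) (rho * expR (e * s))) => //.
- by rewrite subr_ge0.
- move=> M; rewrite mulrBl opprB expRD [_ * expR (- _)]mulrC mulrA.
  by rewrite ler_pM2r ?expR_gt0.
move=> x Ex.
(* Chosen so that c (alpha - e/2) = alpha - e. *)
pose c := (alpha - e) / (alpha - e / 2).
have ae : 0 < alpha - e / 2 by lra.
have c1 : c < 1 by rewrite /c ltr_pdivrMr//; lra.
have c0 : 0 <= c by apply: divr_ge0; lra.
have [x01 H] := E_sup_often psi_gt0 c1 Ex; split => // N.
have [N1 HN1] := Ha (alpha - e / 2) (ltac:(lra)).
have [n] := H (maxn N N1); rewrite geq_max => /andP[Nn N1n] Hn.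
exists n => //; apply: le_trans Hn.
have := ler_wpM2l c0 (HN1 n.+1 (leqW N1n)).
by rewrite mulrA /c divfK// gt_eqF.
Qed.

Lemma hausdorff_dim_E_sup_linear alpha : 0 < alpha ->
  limn_einf (fun n : nat => (psi n / n%:R)%:E) = alpha%:E ->
  hausdorff_dim (E_sup psi) = luroth_H alpha.
Proof.
move=> a0 Hinf.
have uE : pressure_upper alpha (E_sup psi).
  apply: E_sup_pressure_upper => // a aa.
  have h : (a%:E < limn_einf (fun n : nat => (psi n / n%:R)%:E))%E by rewrite Hinf lte_fin.
  have [N HN] := lt_limn_einf_near h; exists N.+1 => -[//|n] Nn.
  by have := HN n.+1 (ltnW Nn); rewrite lte_fin ltr_pdivlMr// => /ltW.
have lE : pressure_lower alpha (E_sup psi).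
  apply: E_sup_pressure_lower => //; first exact: ltW.
  move=> e e0 N.
  have h : (limn_einf (fun n : nat => (psi n / n%:R)%:E) < (alpha + e)%:E)%E.
    by rewrite Hinf lte_fin ltrDl.
  have [[//|n] Nn] := limn_einf_lt_often h N.+1.
  by rewrite lte_fin ltr_pdivrMr// => /ltW Hn; exists n.+1 => //; exact: ltnW.
rewrite /luroth_H; set F := (X in _ = hausdorff_dim X).
have FP x : F x -> 0 < x <= 1 /\ forall N, exists2 n, (N <= n)%N &
    alpha * n.+1%:R <= ln (digit (iter n luroth_map x))%:R.
  move=> [/= x01 infx]; rewrite in_itv/= in x01; split => // N.
  have [n [/= _ Hn] Nn] : exists2 n : nat, [set n : nat | (0 < n)%N /\
      expR (alpha * n%:R) <= (luroth_digit n x)%:~R] n & (N < n)%N.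
    apply: contrapT => H; apply: infx; apply: (@sub_finite_set _ _ `I_N.+1); last exact: finite_II.
    move=> n Sn /=; rewrite ltnNge; apply/negP => Nn; apply: H; by exists n.
  case: n Nn Hn => // n Nn; rewrite luroth_digitE// => Hn; exists n => //.
  rewrite -[leLHS]expRK ler_ln// ?posrE ?expR_gt0//.
  by rewrite ltr0n ltnW// (digit1E (iter_luroth_map_itv n x01)).2.
have uF : pressure_upper alpha F.
  move=> s rho s0 r1 Hr.
  exact: (@hausdorff_dim_le_linear R F s alpha rho s0 (ltW a0) r1 Hr FP).
(* For a slightly above alpha, [E_sup] of the sequence a n is contained in [F], as its points have
   ln d_n >= (alpha/a) a n infinitely often. *)
have lF : pressure_lower alpha F.
  move=> s M s0 s1 h.
  have p0 : 0 < digit_pressure s M by apply: lt_trans h; exact: expR_gt0.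
  have h' : alpha * s < ln (digit_pressure s M).
    by rewrite -[ltLHS]expRK ltr_ln ?posrE ?expR_gt0.
  pose a := (ln (digit_pressure s M) + alpha * s) / 2 / s.
  have as' : alpha < a by rewrite /a ltr_pdivlMr//; lra.
  have aP : expR (a * s) < digit_pressure s M.
    by rewrite -[ltRHS]lnK ?posrE// ltr_expR /a divfK ?gt_eqF//; lra.
  have a0' : 0 < a := lt_trans a0 as'.
  have phi0 (n : nat) : (0 < n)%N -> 0 < a * n%:R by move=> n0; rewrite mulr_gt0// ltr0n.
  have phioo : a * n%:R @[n --> \oo] --> +oo.
    apply/cvgryPge => A; have [N HN] := natr_ge_near (A / a).
    by exists N => // n /HN; rewrite ler_pdivrMr// mulrC.
  apply: (@le_trans _ _ (hausdorff_dim (E_sup (fun n => a * n%:R)))).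
    apply: (@E_sup_pressure_lower R (fun n => a * n%:R) a _ _ _ _ s M) => //.
      exact: ltW.
    by move=> e e0 N; exists N => //; rewrite ler_wpM2r// lerDl ltW.
  apply: hausdorff_dim_subset => x Ex.
  have c1 : alpha / a < 1 by rewrite ltr_pdivrMr// mul1r.
  have [x01 H] := E_sup_often phi0 c1 Ex.
  split; first by rewrite /= in_itv.
  apply: infinite_nat_unbounded => N; have [n Nn Hn] := H N.
  exists n.+1; first exact: leqW.
  split => //; rewrite luroth_digitE//.
  have d0 : 0 < (digit (iter n luroth_map x))%:R :> R.
      by rewrite ltr0n ltnW// (digit1E (iter_luroth_map_itv n x01)).2.
    rewrite -[leRHS]lnK ?posrE// ler_expR; apply: le_trans Hn.
    by rewrite mulrA divfK// gt_eqF.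
by apply/eqP; rewrite eq_le; apply/andP; split;
  apply: (@hausdorff_dim_le_pressure R alpha) => //; exact: ltW.
Qed.

Lemma hausdorff_dim_E_sup_fast : psi n / n%:R @[n --> \oo] --> +oo ->
  forall A : \bar R, (1 <= A)%E ->
  lne A = limn_einf (fun n : nat => (ln (psi n) / n%:R)%:E) ->
  hausdorff_dim (E_sup psi) = ((1 + A)^-1)%E.
Proof.
move=> psin A A1 HA.
have lin L : exists N, forall n, (N <= n)%N -> L * n%:R <= psi n.
  have [N HN] := cvgny_near psin L; exists N.+1 => -[//|n] Nn.
  by have := HN n.+1 (ltnW Nn); rewrite ler_pdivlMr.
(* The value b = 1 is always admissible; otherwise b < A leaves room for B with b < B < A, so that
   psi n >= B^n eventually. *)
have upper (b s : R) : 1 <= b -> (b = 1 \/ (b%:E < A)%E) -> 0 < s -> 1 < s * (1 + b) ->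
    (hausdorff_dim (E_sup psi) <= s%:E)%E.
  move=> b1 cse s0 sb; apply: (@hausdorff_dim_E_sup_le_fast R psi b) => //.
  case: cse => [|bA]; [by left|right].
  have b0 : (0 <= b%:E)%E by rewrite lee_fin (le_trans ler01 b1).
  have [B /andP[bB BA]] := ereal_between b0 bA.
  rewrite lte_fin in bB; exists B; split => //.
  have B0 : 0 < B by apply: lt_trans bB; exact: lt_le_trans b1.
  have h : ((ln B)%:E < limn_einf (fun n : nat => (ln (psi n) / n%:R)%:E))%E.
    rewrite -HA -lne_EFin// lte_lne// in_itv/= leey andbT.
      by rewrite lee_fin ltW.
    by apply: le_trans A1.
  have [N HN] := lt_limn_einf_near h; exists N.+1 => -[//|n] Nn.
  have := HN n.+1 (ltnW Nn); rewrite lte_fin ltr_pdivlMr// => /ltW h1.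
  have p0 := psi_gt0 (ltn0Sn n).
  by rewrite -[leRHS]lnK ?posrE// -[B]lnK ?posrE// -expRM_natr ler_expR.
case: A A1 HA upper => [a| |//]; last first.
  move=> _ _ upper; rewrite addeC /= /inve.
  apply/eqP; rewrite eq_le hausdorff_dim_ge0 andbT.
  (* With b = 1 + 1/s, s (1 + b) = 1 + 2 s > 1. *)
  apply: ereal_le_of_gt => s s0; apply: (upper (1 + s^-1)) => //.
  - by rewrite lerDl invr_ge0 ltW.
  - by right; rewrite ltry.
  - by rewrite !mulrDr divff ?gt_eqF// !mulr1 addrA ltrDr addr_gt0.
rewrite lee_fin => a1 HA upper.
have a0 : 0 < a := lt_le_trans ltr01 a1.
have -> : ((1 + a%:E)^-1 = ((1 + a)^-1)%:E)%E.
  by rewrite -EFinD /inve gt_eqF// addr_gt0.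
apply/eqP; rewrite eq_le; apply/andP; split.
  apply: ereal_le_of_gt => s sa.
  have s0 : 0 < s by apply: lt_trans sa; rewrite invr_gt0 addr_gt0.
  have sa' : 1 < s * (1 + a) by rewrite -ltr_pdivrMr ?addr_gt0// mul1r.
  have [a1'|a1'] := eqVneq a 1.
    by apply: (upper 1) => //; [left|move: sa'; rewrite a1'].
  have ag1 : 1 < a by rewrite lt_neqAle eq_sym a1'.
  (* The midpoint of 1/s - 1 and a lies below a and makes s (1 + b) > 1; the maximum keeps b >=
     1. *)
  pose b := Num.max 1 ((s^-1 - 1 + a) / 2).
  have sV : s^-1 < 1 + a by rewrite -[ltLHS]mul1r ltr_pdivrMr// mulrC.
  have ba : b < a by rewrite gt_max ag1/=; lra.
  apply: (upper b) => //; first by rewrite le_max lexx.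
    by right; rewrite lte_fin.
  have : (s^-1 - 1 + a) / 2 <= b by rewrite le_max lexx orbT.
  move=> hb; rewrite mulrC -ltr_pdivrMr// mul1r; lra.
apply: ereal_ge_of_lt => [|s s0 sa]; first exact: hausdorff_dim_ge0.
have sa' : a < s^-1 - 1.
  by rewrite ltrBrDl -[ltLHS]invrK ltf_pV2 ?posrE ?invr_gt0 ?addr_gt0.
(* Now 1/s - 1 exceeds a, so the midpoint gives b > a with s (1 + b) < 1, and [beta] separates ln a
   from ln b. *)
pose b := (s^-1 - 1 + a) / 2.
have ab : a < b by rewrite /b; lra.
have lnab : ln a < ln b by rewrite ltr_ln ?posrE// (lt_trans a0).
pose beta := (ln a + ln b) / 2.
apply: (@hausdorff_dim_E_sup_ge_growing R psi b beta) => //.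
- by apply: le_lt_trans ab.
- by rewrite /beta; lra.
- move=> N.
  have h : (limn_einf (fun n : nat => (ln (psi n) / n%:R)%:E) < beta%:E)%E.
    by rewrite -HA lne_EFin// lte_fin /beta; lra.
  have [[//|n] Nn] := limn_einf_lt_often h N.+1.
  by rewrite lte_fin ltr_pdivrMr// => /ltW Hn; exists n.+1 => //; exact: ltnW.
- rewrite mulrC -ltr_pdivlMr// mul1r /b; lra.
Qed.

End Cases.

Theorem theorem1p1 (R : realType) (psi : nat -> R)
  (psi_gt0 : forall n : nat, (0 < n)%N -> 0 < psi n)
  (psi_cvg : psi n @[n --> \oo] --> +oo) :
  [/\ psi n / n%:R @[n --> \oo] --> 0 ->
        hausdorff_dim (E_sup psi) = 1%E,
      forall alpha : R, 0 < alpha ->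
        limn_einf (fun n : nat => (psi n / n%:R)%:E) = alpha%:E ->
        hausdorff_dim (E_sup psi) = luroth_H alpha
    & psi n / n%:R @[n --> \oo] --> +oo ->
        forall A : \bar R, (1 <= A)%E ->
        lne A = limn_einf (fun n : nat => (ln (psi n) / n%:R)%:E) ->
        hausdorff_dim (E_sup psi) = ((1 + A)^-1)%E].
Proof.
split.
- exact: hausdorff_dim_E_sup_slow.
- exact: hausdorff_dim_E_sup_linear.
- exact: hausdorff_dim_E_sup_fast.
Qed.
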